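(* There is an absolute constant $C$ such that for all integers $k\ge2$ and reals $q\ge1$, $s\ge k$: if every planar $k$-terminal network whose terminals all lie on one face admits a $(q,s)$-distance-approximating minor, then every planar $k$-terminal network whose terminals all lie on one face admits a minor cut sparsifier of quality $q$ and size at most $Cs$.
   Context: A $k$-terminal network $G=(V,E,T,c)$ is a finite connected undirected graph with nonnegative edge weights $c$ and a set $T\subseteq V$ of $k$ terminals. For $S\subset T$, $S\neq\emptyset,T$, $\mathrm{mincut}_G(S)$ is the minimum total weight of edges with exactly one endpoint in $W$, over $W\subseteq V$ with $W\cap T\in\{S,T\setminus S\}$. A network $H=(V_H,E_H,T,c_H)$ with the same terminals is a cut sparsifier of $G$ of quality $q$ and size $s$ if $|V_H|\le s$ and $\mathrm{mincut}_G(S)\le\mathrm{mincut}_H(S)\le q\,\mathrm{mincut}_G(S)$ for all such $S$; it is a minor cut sparsifier if moreover $H$ is a minor of $G$ (terminals remaining distinct vertices). With $c$ viewed as edge lengths, $d_G$ denotes the shortest-path metric; $H$ is a $(q,s)$-distance-approximating minor (DAM) of $G$ if $H$ is a minor of $G$ with terminal set $T$, $|V_H|\le s$, and $d_G(t,t')\le d_H(t,t')\le q\,d_G(t,t')$ for all $t,t'\in T$. *)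

(* Defs.v *)
From HB Require Import structures.
From mathcomp Require Import all_boot all_order all_algebra.
From mathcomp Require Import reals.
Unset Printing Implicit Defensive.
Import Order.TTheory GRing.Theory Num.Theory.
Local Open Scope ring_scope.

Record network (R : realType) (k : nat) := Network {
  nv : finType;
  nadj : rel nv;
  nw : nv -> nv -> R;
  nterm : 'I_k -> nv }.
Arguments nv {R k}. Arguments nadj {R k}. Arguments nw {R k}. Arguments nterm {R k}.

Section Defs.
Context {R : realType} {k : nat}.

Definition is_network (G : network R k) : Prop :=
  [/\ symmetric (nadj G), irreflexive (nadj G),
      (forall x y, nadj G x y -> 0 <= nw G x y /\ nw G x y = nw G y x),
      injective (nterm G) &
      (forall x y, connect (nadj G) x y)].

Definition cutval (G : network R k) (W : {set nv G}) : R :=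
  \sum_(x in W) \sum_(y | (y \notin W) && nadj G x y) nw G x y.

Definition cut_feasible (G : network R k) (S : {set 'I_k}) (W : {set nv G}) :=
  (W :&: (nterm G @: [set: 'I_k]) == nterm G @: S) ||
  (W :&: (nterm G @: [set: 'I_k]) == nterm G @: (~: S)).

Definition mincut (G : network R k) (S : {set 'I_k}) : R :=
  inf (fun r => exists W : {set nv G}, cut_feasible G S W /\ r = cutval G W).

Definition walk_len (G : network R k) (x : nv G) (p : seq (nv G)) : R :=
  \sum_(e <- zip (x :: p) p) nw G e.1 e.2.

Definition dist (G : network R k) (x y : nv G) : R :=
  inf (fun r => exists p : seq (nv G),
         [/\ path (nadj G) x p, last x p = y & r = walk_len G x p]).

Definition is_minor (H G : network R k) : Prop :=
  exists beta : nv H -> {set nv G},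
  [/\ forall u, beta u != set0,
      forall u x y, x \in beta u -> y \in beta u ->
        connect [rel a b | [&& nadj G a b, a \in beta u & b \in beta u]] x y,
      forall u v, u != v -> [disjoint beta u & beta v],
      forall u v, nadj H u v ->
        exists x, exists y, [/\ x \in beta u, y \in beta v & nadj G x y] &
      forall i, nterm G i \in beta (nterm H i)].

(* Planarity via combinatorial embeddings (rotation systems).  Darts are the
   ordered pairs (x,y) with xy an edge.  A rotation rho maps each dart to a
   dart with the same tail, is injective on darts, and cyclically permutes
   the darts around each vertex.  Face successor: phi (x,y) = rho (y,x).
   Faces are the phi-orbits of darts; the embedding is in the sphere iff
   Euler's formula V - E + F = 2 holds (G connected). *)
Definition darts (G : network R k) : {set nv G * nv G} :=
  [set d | nadj G d.1 d.2].

Definition face_succ (G : network R k) (rho : nv G * nv G -> nv G * nv G)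
  (d : nv G * nv G) := rho (d.2, d.1).

Definition rotation_system (G : network R k) (rho : nv G * nv G -> nv G * nv G) :=
  [/\ forall d, d \in darts G -> rho d \in darts G /\ (rho d).1 = d.1,
      {in darts G &, injective rho} &
      forall d d', d \in darts G -> d' \in darts G -> d.1 = d'.1 ->
        fconnect rho d d'].

Definition faces (G : network R k) (rho : nv G * nv G -> nv G * nv G) :=
  [set [set d' | fconnect (face_succ G rho) d d'] | d in darts G].

Definition spherical (G : network R k) (rho : nv G * nv G -> nv G * nv G) :=
  (2 * #|nv G| + 2 * #|faces G rho| = #|darts G| + 4)%N.

Definition planar_terminals_one_face (G : network R k) : Prop :=
  exists rho, [/\ rotation_system G rho, spherical G rho &
    exists2 d0, d0 \in darts G & forall i, exists2 d, d \in darts G &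
        fconnect (face_succ G rho) d0 d /\ d.1 = nterm G i].

Definition is_DAM (q s : R) (G H : network R k) : Prop :=
  [/\ is_network H, is_minor H G, (#|nv H|%:R <= s) &
      forall i j, dist G (nterm G i) (nterm G j) <= dist H (nterm H i) (nterm H j)
                  <= q * dist G (nterm G i) (nterm G j)].

Definition is_minor_cut_sparsifier (q s : R) (G H : network R k) : Prop :=
  [/\ is_network H, is_minor H G, (#|nv H|%:R <= s) &
      forall S : {set 'I_k}, S != set0 -> S != [set: 'I_k] ->
        mincut G S <= mincut H S <= q * mincut G S].

End Defs.

(* Main.v *)
Require Import Defs.
From HB Require Import structures.
From mathcomp Require Import all_boot all_order all_fingroup all_algebra.
From mathcomp Require classical_sets.
From mathcomp Require Import boolp reals.
From mathcomp Require Import zify lra.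
Set Implicit Arguments.
Unset Strict Implicit.
Unset Printing Implicit Defensive.
Import Order.TTheory GRing.Theory Num.Theory.
Local Open Scope ring_scope.

(** Minimum cuts of [G] are, modulo 2, [T]-joins of the planar dual: if the outer
    face is cut open at the terminals into [k] arcs, a cut separating [S] becomes
    an edge set whose odd vertices are the arcs joining a terminal of [S] to one
    outside [S]. Conversely every edge set with these odd vertices is a cut, by
    Euler's formula. A [T]-join splits into paths between dual terminals, so its
    least weight is controlled by the dual terminal distances: if [M] approximates
    these distances then minimum [T]-joins of [M] approximate the minimum cuts of [G].

    If moreover [M] is a minor of the dual, choose a minimal set [U] of dual edges
    realizing it. Contracting the edges of [G] not in [U] gives the sparsifier,
    with weights read off from [M]. No embedding of [M] is needed to bound its size:
    if [M] has [n] vertices and [b] edges and the contraction has [v] vertices, then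
    the even edge sets of [M] are cuts of the contraction, so [b <= n + v]; and each
    vertex other than the [k] terminals gives a nonempty even edge set of [M], which
    has at least 3 edges, so [3 (v - k) <= 2 b]. Hence [v <= 3 k + 2 n]. *)

(** * Binary chains on graphs *)

(** Cutting the outer face open amounts to gluing the [k] terminals into one vertex across that
    face. Vertices drop by [k - 1] and faces grow by [k - 1], so Euler's formula survives. The glued
    vertex becomes a face of the dual that touches all [k] arcs, which is what puts the dual
    terminals on one face. The correspondence between cuts and joins is proved on the unglued map,
    where the terminals are still distinct vertices.

    A cut survives the contraction only if its whole dual lies in [U]. Two opposite properties of
    [U] make this harmless. Its branch sets are connected, so a chain of [M] lifts to [U] with any
    admissible boundary. By minimality they are also forests, so no nonzero even chain of [U]
    vanishes in [M]. The first gives the quality, the second makes every vertex of the contraction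
    visible in [M] and so bounds their number.

    Distances are infima over walks, so comparisons of weights carry an arbitrary positive slack
    that is removed at the end. Edge sets are symmetric relations, and [bd] is their boundary modulo
    2. *)

Definition bd {V : finType} (z : rel V) (x : V) : bool :=
  \big[addb/false]_y z x y.

(** Orienting every edge by the rank of its ends splits the sum into two equal halves, which
    cancel. *)
Lemma xor_sym_eq0 {V : finType} (B : pred V) (z : rel V) :
  symmetric z -> irreflexive z ->
  \big[addb/false]_(x | B x) \big[addb/false]_(y | B y) z x y = false.
Proof.
move=> zs zi.
pose lt (x y : V) := (enum_rank x < enum_rank y)%N.
have zE x y : z x y = (z x y && lt x y) (+) (z x y && lt y x).
  rewrite /lt; case: (ltngtP (enum_rank x) (enum_rank y)) => [_|_|/val_inj/enum_rank_inj->].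
  - by rewrite andbT andbF addbF.
  - by rewrite andbT andbF.
  - by rewrite zi.
under eq_bigr do under eq_bigr do rewrite zE.
under eq_bigr do rewrite big_split.
rewrite big_split /= [X in _ (+) X]exchange_big /=.
rewrite [X in _ (+) X](_ : _ = \big[addb/false]_(x | B x)
   \big[addb/false]_(y | B y) (z x y && lt x y)) ?addbb //.
by apply: eq_bigr => x _; apply: eq_bigr => y _; rewrite zs.
Qed.

Lemma xor_bd_cut {V : finType} (B : pred V) (z : rel V) :
  symmetric z -> irreflexive z ->
  \big[addb/false]_(x | B x) bd z x =
  \big[addb/false]_(x | B x) \big[addb/false]_(y | ~~ B y) z x y.
Proof.
move=> zs zi; rewrite -[RHS]addFb -[X in X (+) _](xor_sym_eq0 B zs zi) -big_split /=.
by apply: eq_bigr => x _; rewrite /bd (bigID B).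
Qed.

Lemma xor_pred1 {V : finType} (x : V) (F : V -> bool) :
  \big[addb/false]_y ((y == x) && F y) = F x.
Proof.
rewrite (bigD1 x) //= eqxx big1 ?addbF // => y /negbTE->.
by [].
Qed.

Definition addc {V : Type} (z1 z2 : rel V) : rel V := fun x y => z1 x y (+) z2 x y.

Lemma bd_addc {V : finType} (z1 z2 : rel V) x :
  bd (addc z1 z2) x = bd z1 x (+) bd z2 x.
Proof. by rewrite /bd -big_split. Qed.

Lemma addc_sym {V : Type} (z1 z2 : rel V) :
  symmetric z1 -> symmetric z2 -> symmetric (addc z1 z2).
Proof. by move=> s1 s2 x y; rewrite /addc s1 s2. Qed.

Lemma addc_sub {V : Type} (e z1 z2 : rel V) :
  subrel z1 e -> subrel z2 e -> subrel (addc z1 z2) e.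
Proof. by move=> s1 s2 x y; rewrite /addc; case E: (z1 x y); [move=> _; apply: s1|apply: s2]. Qed.

Definition edge_chain {V : finType} (a b : V) : rel V :=
  fun x y => ((x == a) && (y == b)) || ((x == b) && (y == a)).

Lemma edge_chain_sym {V : finType} (a b : V) : symmetric (edge_chain a b).
Proof. by move=> x y; rewrite /edge_chain orbC [in RHS]andbC [X in _ || X]andbC. Qed.

Lemma edge_chain_sub {V : finType} (e : rel V) (a b : V) :
  symmetric e -> e a b -> subrel (edge_chain a b) e.
Proof. by move=> es eab x y /orP[]/andP[/eqP-> /eqP->] //; rewrite es. Qed.

Lemma bd_edge_chain {V : finType} (a b x : V) :
  a != b -> bd (edge_chain a b) x = (x == a) (+) (x == b).
Proof.
move=> nab; rewrite /bd.
rewrite (eq_bigr (fun y => ((y == b) && (x == a)) (+) ((y == a) && (x == b)))).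
  by rewrite big_split /= (xor_pred1 b (fun=> x == a)) (xor_pred1 a (fun=> x == b)).
move=> y _; rewrite /edge_chain andbC [X in _ || X]andbC.
by case: (eqVneq y b) => // ->; rewrite [b == a]eq_sym (negbTE nab) /= orbF addbF.
Qed.

Lemma connect_chain {V : finType} (e : rel V) (x y : V) :
  symmetric e -> irreflexive e -> connect e x y ->
  exists z : rel V, [/\ symmetric z, subrel z e &
    forall v, bd z v = (v == x) (+) (v == y)].
Proof.
move=> es ei /connectP[p]; elim: p x => [|a p IH] x /=.
  move=> _ ->; exists (fun _ _ => false); split=> // v.
  by rewrite addbb /bd big1.
case/andP=> exa pp yE; have [z [zs zsub zb]] := IH a pp yE.
exists (addc (edge_chain x a) z); split.
- by apply: addc_sym => //; exact: edge_chain_sym.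
- by apply: addc_sub => //; exact: edge_chain_sub.
move=> v; rewrite bd_addc bd_edge_chain ?zb.
  by rewrite addbA addbK.
by apply: contraTneq exa => ->; rewrite ei.
Qed.

(** Join each vertex of [p] to one base point by a path and add the paths modulo 2. The base point
    is toggled once per vertex of [p], hence an even number of times. *)
Lemma even_set_chain {V : finType} (e : rel V) (B p : pred V) :
  symmetric e -> irreflexive e ->
  {in B &, forall x y, connect e x y} -> (forall x, p x -> B x) ->
  \big[addb/false]_x p x = false ->
  exists z : rel V, [/\ symmetric z, subrel z e & bd z =1 p].
Proof.
move=> es ei con pB p0.
have [b Bb|B0] := pickP B; last first.
  exists (fun _ _ => false); split=> // x; rewrite /bd big1 //.
  by case E: (p x) => //; have := pB _ E; rewrite B0.
have /choice[F FP] x : exists z : rel V, [/\ symmetric z, subrel z e &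
    B x -> forall v, bd z v = (v == x) (+) (v == b)].
  case Bx: (B x); last by exists (fun _ _ => false).
  by have [z [? ? ?]] := @connect_chain _ e x b es ei (con _ _ Bx Bb); exists z.
exists (fun u v => \big[addb/false]_(x | p x) F x u v); split.
- by move=> u v; apply: eq_bigr => x _; case: (FP x).
- move=> u v; apply: contraTT => nuv; rewrite big1 // => x _.
  by case: (FP x) => _ sub _; apply/negbTE; apply: contra nuv; exact: sub.
move=> v; rewrite /bd exchange_big /=.
transitivity (\big[addb/false]_(x | p x) ((v == x) (+) (v == b))).
  by apply: eq_bigr => x px; case: (FP x) => _ _ <- //; exact: pB.
rewrite big_split /= (big_mkcond p) /=.
rewrite (eq_bigr (fun x => (x == v) && p x)); last first.
  by move=> x _; rewrite eq_sym; case: (p x); rewrite ?andbT ?andbF.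
rewrite xor_pred1 big_mkcond /= (eq_bigr (fun x => p x && (v == b))).
  by rewrite -big_distrl /= p0 addbF.
by move=> x _; case: (p x).
Qed.

(** * Lists of vertex pairs *)

Definition par {V : finType} (l : seq (V * V)) (v : V) : bool :=
  \big[addb/false]_(p <- l) ((p.1 == v) (+) (p.2 == v)).

Definition verts {V : Type} (l : seq (V * V)) : seq V :=
  flatten [seq [:: p.1; p.2] | p <- l].

Lemma verts_split {V : finType} (l : seq (V * V)) v :
  v \in verts l -> exists z l0,
    perm_eq l ((v, z) :: l0) \/ perm_eq l ((z, v) :: l0).
Proof.
case/flatten_mapP=> -[a b] pl; rewrite !inE /=.
by case/orP=> /eqP->; [exists b, (rem (a, b) l); left|exists a, (rem (a, b) l); right];
  apply: perm_to_rem.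
Qed.

Lemma perm_verts {V : eqType} (l l' : seq (V * V)) :
  perm_eq l l' -> perm_eq (verts l) (verts l').
Proof. by move=> pl; apply/perm_flatten/perm_map. Qed.

Section Pairs.
Context {R : realType} {V : finType}.
Variable c : V -> V -> R.
Hypothesis c_sym : forall x y, c x y = c y x.
Hypothesis c_tri : forall x y z, c x z <= c x y + c y z.
Hypothesis c_ge0 : forall x y, 0 <= c x y.

Let cost (l : seq (V * V)) := \sum_(p <- l) c p.1 p.2.

(** If an end of the new pair is already matched, say [x] to [z], the two pairs through [x] are
    replaced by [(z, y)]. The triangle inequality controls the cost, and it remains to insert this
    pair into a shorter list. *)
Lemma insert_pair n (l : seq (V * V)) x y : (size l <= n)%N -> uniq (verts l) ->
  exists l', [/\ uniq (verts l'), par l' =1 par ((x, y) :: l) &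
                 cost l' <= c x y + cost l].
Proof.
elim: n l x y => [|n IH] l x y sl ul.
  rewrite leqn0 size_eq0 in sl; rewrite (eqP sl) /cost big_nil addr0.
  have [->|nxy] := eqVneq x y; last first.
    by exists [:: (x, y)]; rewrite big_seq1 /= inE nxy.
  exists [::]; rewrite big_nil; split=> // v.
  by rewrite /par big_cons big_nil /= addbb.
have [->|nxy] := eqVneq x y.
  exists l; split=> // [v|]; last by rewrite lerDr.
  by rewrite /par big_cons /= addbb.
have split_step a z l0 p0 : p0 = (a, z) \/ p0 = (z, a) -> perm_eq l (p0 :: l0) ->
    [/\ (size l0 <= n)%N, uniq (verts l0), cost l = c z a + cost l0 &
      forall v, par l v = (z == v) (+) (a == v) (+) par l0 v].
  move=> p0E pl; split.
  - by move: sl; rewrite (perm_size pl).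
  - by move: ul; rewrite (perm_uniq (perm_verts pl)) /= => /and3P[].
  - by rewrite /cost (perm_big _ pl) big_cons; case: p0E => -> //; rewrite c_sym.
  - move=> v; rewrite /par (perm_big _ pl) big_cons.
    by case: p0E => -> //=; rewrite [X in X (+) _]addbC.
have [/verts_split[z [l0 pl]]|nx] := boolP (x \in verts l).
  have [p0 [p0E pl0]] : exists p0, (p0 = (x, z) \/ p0 = (z, x)) /\ perm_eq l (p0 :: l0).
    by case: pl => pl; [exists (x, z)|exists (z, x)]; split=> //; [left|right].
  have [s0 u0 c0 par0] := split_step _ _ _ _ p0E pl0.
  have [l' [ul' pl' cl']] := IH l0 z y s0 u0.
  exists l'; split=> // [v|].
    rewrite pl' /par !big_cons /= -![\big[addb/false]_(j <- _) _]/(par _ v) par0.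
    by case: (z == v); case: (x == v); case: (y == v); case: (par _ _).
  apply: (le_trans cl'); rewrite c0 addrA lerD2r.
  by rewrite addrC; exact: c_tri.
have [/verts_split[z [l0 pl]]|ny] := boolP (y \in verts l).
  have [p0 [p0E pl0]] : exists p0, (p0 = (y, z) \/ p0 = (z, y)) /\ perm_eq l (p0 :: l0).
    by case: pl => pl; [exists (y, z)|exists (z, y)]; split=> //; [left|right].
  have [s0 u0 c0 par0] := split_step _ _ _ _ p0E pl0.
  have [l' [ul' pl' cl']] := IH l0 x z s0 u0.
  exists l'; split=> // [v|].
    rewrite pl' /par !big_cons /= -![\big[addb/false]_(j <- _) _]/(par _ v) par0.
    by case: (z == v); case: (x == v); case: (y == v); case: (par _ _).
  apply: (le_trans cl'); rewrite c0 addrA lerD2r.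
  by rewrite [c z y]c_sym; exact: c_tri.
exists ((x, y) :: l); split=> //; last by rewrite /cost big_cons.
by rewrite /= inE negb_or nxy nx ny.
Qed.

(** Shortcutting takes the place of splitting a join into paths: the result is a matching of the odd
    vertices. *)
Lemma uniq_pairs (l : seq (V * V)) :
  exists l', [/\ uniq (verts l'), par l' =1 par l & cost l' <= cost l].
Proof.
elim: l => [|[x y] l [l' [ul' pl' cl']]]; first by exists [::].
have [l2 [ul2 pl2 cl2]] := insert_pair x y (leqnn (size l')) ul'.
exists l2; split=> // [v|].
  by rewrite pl2 /par !big_cons -![\big[addb/false]_(j <- _) _]/(par _ v) pl'.
by rewrite (le_trans cl2) // {2}/cost big_cons lerD2l.
Qed.

Lemma par_uniq_verts (l : seq (V * V)) v : uniq (verts l) -> par l v = (v \in verts l).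
Proof.
rewrite /par; elim: l => [|[x y] l IH] /=; first by rewrite big_nil.
rewrite big_cons inE negb_or => /and3P[/andP[nxy nx] ny ul]; rewrite IH //= !inE.
rewrite [x == v]eq_sym [y == v]eq_sym.
have [->|_] := eqVneq v x; first by rewrite (negbTE nxy) (negbTE nx).
by have [->|] := eqVneq v y; rewrite ?(negbTE ny).
Qed.

End Pairs.

(** * Distances and chains in networks *)

Section NetworkDist.
Context {R : realType} {k : nat} (N : network R k).
Hypothesis hN : is_network N.

Lemma nadj_sym : symmetric (nadj N). Proof. by case: hN. Qed.
Lemma nadj_irr : irreflexive (nadj N). Proof. by case: hN. Qed.
Lemma nw_ge0 x y : nadj N x y -> 0 <= nw N x y.
Proof. by case: hN => _ _ h _ _ /h[]. Qed.
Lemma nw_sym x y : nadj N x y -> nw N x y = nw N y x.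
Proof. by case: hN => _ _ h _ _ /h[]. Qed.
Lemma nterm_inj : injective (nterm N). Proof. by case: hN. Qed.
Lemma network_connected x y : connect (nadj N) x y. Proof. by case: hN. Qed.

Lemma walk_len_cons x a p : walk_len N x (a :: p) = nw N x a + walk_len N a p.
Proof. by rewrite /walk_len /= big_cons. Qed.

Lemma walk_len_cat x p q :
  walk_len N x (p ++ q) = walk_len N x p + walk_len N (last x p) q.
Proof.
elim: p x => [|a p IH] x /=; first by rewrite {2}/walk_len big_nil add0r.
by rewrite !walk_len_cons IH addrA.
Qed.

Lemma walk_len_ge0 x p : path (nadj N) x p -> 0 <= walk_len N x p.
Proof.
elim: p x => [|a p IH] x /=; first by rewrite /walk_len big_nil.
by case/andP=> xa pp; rewrite walk_len_cons addr_ge0 ?IH // nw_ge0.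
Qed.

Let walks x y : R -> Prop := fun r => exists p : seq (nv N),
  [/\ path (nadj N) x p, last x p = y & r = walk_len N x p].

Lemma dist_le_walk x p : path (nadj N) x p -> dist N x (last x p) <= walk_len N x p.
Proof.
move=> pp; apply: (@ge_inf _ (walks x (last x p))); last by exists p.
by exists 0 => _ [p' [pp' _ ->]]; exact: walk_len_ge0.
Qed.

Lemma near_dist x y e : 0 < e -> exists p,
  [/\ path (nadj N) x p, last x p = y & walk_len N x p < dist N x y + e].
Proof.
move=> e0.
have hi : classical_sets.has_inf (walks x y).
  split; last by exists 0 => _ [p [pp _ ->]]; exact: walk_len_ge0.
  by have /connectP[p pp yE] := network_connected x y; exists (walk_len N x p), p.
by have [_ [p [pp lp ->]] lt] := inf_adherent e0 hi; exists p.
Qed.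

Lemma dist_ge0 x y : 0 <= dist N x y.
Proof.
apply: lb_le_inf; last by move=> _ [p [pp _ ->]]; exact: walk_len_ge0.
by have /connectP[p pp yE] := network_connected x y; exists (walk_len N x p), p.
Qed.

Lemma dist_triangle x y z : dist N x z <= dist N x y + dist N y z.
Proof.
apply/ler_addgt0Pr => e e0.
have e2 : 0 < e / 2 by rewrite divr_gt0.
have [p [pp py lp]] := near_dist x y e2; have [p' [pp' pz lp']] := near_dist y z e2.
have := @dist_le_walk x (p ++ p'); rewrite cat_path pp py pp' last_cat py pz.
rewrite walk_len_cat py => /(_ isT); lra.
Qed.

Lemma dist_le_edge x y : nadj N x y -> dist N x y <= nw N x y.
Proof.
move=> xy; have := @dist_le_walk x [:: y]; rewrite /= xy => /(_ isT).
by rewrite walk_len_cons /walk_len /= big_nil addr0.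
Qed.

Lemma rev_walk x p : path (nadj N) x p -> exists p',
  [/\ path (nadj N) (last x p) p', last (last x p) p' = x &
      walk_len N (last x p) p' = walk_len N x p].
Proof.
elim: p x => [|a p IH] x /=; first by exists [::].
case/andP=> xa /IH[p' [pp' lp' wp']]; exists (rcons p' x).
rewrite rcons_path pp' lp' nadj_sym xa last_rcons; split=> //.
rewrite -cats1 walk_len_cat lp' walk_len_cons wp' walk_len_cons.
by rewrite [nw N a x]nw_sym 1?nadj_sym // /walk_len /= big_nil addr0 addrC.
Qed.

Lemma dist_sym x y : dist N x y = dist N y x.
Proof.
suff h u v : dist N u v <= dist N v u by apply/eqP; rewrite eq_le !h.
apply/ler_addgt0Pr => e e0; have [p [pp lp wp]] := near_dist v u e0.
have [p' [pp' lp' wp']] := rev_walk pp.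
by have := dist_le_walk pp'; rewrite lp' wp' lp => /le_trans; apply; exact: ltW.
Qed.

Definition is_chain (z : rel (nv N)) : Prop := symmetric z /\ subrel z (nadj N).

(** The sum runs over ordered pairs, so each edge counts twice; hence the factors [*+ 2] below. *)
Definition wt (z : rel (nv N)) : R := \sum_x \sum_(y | z x y) nw N x y.

Lemma chain_irr (z : rel (nv N)) : subrel z (nadj N) -> irreflexive z.
Proof. by move=> s x; apply/negP => /s; rewrite nadj_irr. Qed.

Lemma wt_addc z1 z2 : subrel z1 (nadj N) -> subrel z2 (nadj N) ->
  wt (addc z1 z2) <= wt z1 + wt z2.
Proof.
move=> s1 s2; rewrite /wt -[X in _ <= X]big_split; apply: ler_sum => x _ /=.
rewrite (big_mkcond (addc z1 z2 x)) (big_mkcond (z1 x)) (big_mkcond (z2 x)).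
rewrite -[X in _ <= X]big_split /=; apply: ler_sum => y _.
rewrite /addc.
case E1: (z1 x y); case E2: (z2 x y) => //=; rewrite ?addr0 ?add0r //.
by rewrite addr_ge0 // nw_ge0 // s1.
Qed.

Lemma wt_edge_chain a b : nadj N a b -> wt (edge_chain a b) = nw N a b *+ 2.
Proof.
move=> ab; have nab : a != b by apply: contraTneq ab => ->; rewrite nadj_irr.
rewrite /wt (bigD1 a) //= [X in _ + X](bigD1 b) 1?eq_sym //=.
rewrite [X in _ + (_ + X)]big1 => [|x /andP[xa xb]]; last first.
  by rewrite big_pred0 // => y; rewrite /edge_chain (negbTE xa) (negbTE xb).
rewrite addr0 (big_pred1 b) => [|y]; last first.
  by rewrite /edge_chain eqxx (negbTE nab) /= orbF.
rewrite (big_pred1 a) => [|y]; last first.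
  by rewrite /edge_chain eqxx [b == a]eq_sym (negbTE nab).
by rewrite [nw N b a]nw_sym ?mulr2n 1?nadj_sym.
Qed.

(** Edges traversed repeatedly cancel modulo 2, which can only lower the weight. *)
Lemma walk_chain x p : path (nadj N) x p -> exists z,
  [/\ is_chain z, forall v, bd z v = (x == v) (+) (last x p == v) &
      wt z <= walk_len N x p *+ 2].
Proof.
elim: p x => [|a p IH] x /=.
  move=> _; exists (fun _ _ => false); split=> // [v|]; first by rewrite addbb /bd big1.
  by rewrite /wt /walk_len /= big_nil mul0rn big1 // => y _; rewrite big_pred0.
case/andP=> xa /IH[z [[zs zn] zb zw]]; exists (addc (edge_chain x a) z); split.
- split; first by apply: addc_sym => //; exact: edge_chain_sym.
  by apply: addc_sub => //; exact: edge_chain_sub nadj_sym xa.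
- move=> v; rewrite bd_addc bd_edge_chain ?zb.
    by rewrite [v == x]eq_sym [v == a]eq_sym addbA addbK.
  by apply: contraTneq xa => ->; rewrite nadj_irr.
- apply: le_trans (wt_addc _ zn) _; first exact: edge_chain_sub nadj_sym xa.
  by rewrite walk_len_cons mulrnDl wt_edge_chain // lerD2l.
Qed.

Definition on_terms (tau : pred 'I_k) (v : nv N) : bool :=
  [exists i, (nterm N i == v) && tau i].

Lemma on_termsE tau i : on_terms tau (nterm N i) = tau i.
Proof.
apply/existsP/idP => [[j /andP[/eqP/nterm_inj->]] //|ti].
by exists i; rewrite eqxx.
Qed.

(** Each edge of the chain is a pair whose distance is at most its weight. The matching extracted
    from these pairs covers exactly the odd vertices, and these are terminals. *)
Lemma chain_pairs (tau : pred 'I_k) z : is_chain z -> bd z =1 on_terms tau ->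
  exists l : seq ('I_k * 'I_k), par l =1 tau /\
    (\sum_(p <- l) dist N (nterm N p.1) (nterm N p.2)) *+ 2 <= wt z.
Proof.
move=> [zs zn] zb; have zi := chain_irr zn.
(* [lt] selects one orientation of each edge, so [l0] lists every edge once. *)
pose lt (x y : nv N) := (enum_rank x < enum_rank y)%N.
pose l0 := [seq p <- enum {: nv N * nv N} | z p.1 p.2 && lt p.1 p.2].
have par0 v : par l0 v = bd z v.
  rewrite /par big_filter big_enum_cond /=.
  transitivity (\big[addb/false]_x \big[addb/false]_(y | z x y && lt x y)
      ((x == v) (+) (y == v))).
    by rewrite pair_big_dep; apply: eq_big => [[x y]|[x y]].
  under eq_bigr do rewrite big_split; rewrite big_split /=.
  rewrite [X in _ (+) X](exchange_big_dep xpredT) //=.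
  transitivity (\big[addb/false]_x ((x == v) && (\big[addb/false]_(y | lt x y) z x y))
     (+) \big[addb/false]_x ((x == v) && (\big[addb/false]_(y | lt y x) z x y))).
    congr (_ (+) _); apply: eq_bigr => x _; rewrite big_distrr /= big_mkcond [RHS]big_mkcond;
    apply: eq_bigr => y _.
      by case: (z x y); rewrite /= ?andbT ?andbF //; case: ifP.
    by rewrite [z y x]zs; case: (z x y); rewrite /= ?andbT ?andbF //; case: ifP.
  rewrite !xor_pred1 /bd [RHS](bigID (fun y => lt v y)) /=; congr (_ (+) _).
  rewrite big_mkcond [RHS]big_mkcond; apply: eq_bigr => y _; rewrite /lt.
  by case: ltngtP => // /val_inj/enum_rank_inj->; rewrite zi.
have cost0 : (\sum_(p <- l0) dist N p.1 p.2) *+ 2 <= wt z.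
  rewrite big_filter big_enum_cond /=.
  have -> : \sum_(p : nv N * nv N | z p.1 p.2 && lt p.1 p.2) dist N p.1 p.2 =
     \sum_x \sum_(y | z x y && lt x y) dist N x y.
    by rewrite pair_big_dep; apply: eq_big => [[x y]|[x y]].
  rewrite mulr2n {2}(exchange_big_dep xpredT) //= -big_split /=.
  apply: ler_sum => x _; rewrite [X in _ <= X](bigID (fun y => lt x y)) /=.
  apply: lerD; first by apply: ler_sum => y /andP[/zn/dist_le_edge].
  rewrite [X in _ <= X](eq_bigl (fun y => z y x && lt y x)) => [|y].
    by apply: ler_sum => y /andP[/zn yx _]; rewrite -nw_sym // dist_le_edge.
  rewrite zs; case E: (z y x) => //=; rewrite /lt.
  by case: ltngtP => // /val_inj/enum_rank_inj yx; move: E; rewrite yx zi.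
have [l1 [ul1 par1 cost1]] := uniq_pairs dist_sym dist_triangle dist_ge0 l0.
have term1 v : v \in verts l1 -> exists2 i, nterm N i = v & tau i.
  rewrite -par_uniq_verts // par1 par0 zb => /existsP[i /andP[/eqP ? ?]].
  by exists i.
have [l lE] : exists l : seq ('I_k * 'I_k),
    l1 = [seq (nterm N p.1, nterm N p.2) | p <- l].
  elim: (l1) term1 => [|[x y] l2 IH] tm; first by exists [::].
  have [|l ->] := IH; first by move=> v vl; apply: tm; rewrite /= !inE vl !orbT.
  have [i <- _] : exists2 i, nterm N i = x & tau i by apply: tm; rewrite /= !inE eqxx.
  have [j <- _] : exists2 j, nterm N j = y & tau j.
    by apply: tm; rewrite /= !inE eqxx orbT.
  by exists ((i, j) :: l).
exists l; split.
  move=> i; rewrite -[tau i]on_termsE -zb -par0 -par1 lE /par big_map.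
  by apply: eq_bigr => -[a b] _ /=; rewrite !(inj_eq nterm_inj).
apply: le_trans cost0; rewrite lerMn2r /=; apply: le_trans cost1.
by rewrite lE big_map.
Qed.

Lemma pairs_chain (l : seq ('I_k * 'I_k)) e : 0 < e ->
  exists z, [/\ is_chain z, bd z =1 on_terms (par l) &
    wt z <= (\sum_(p <- l) dist N (nterm N p.1) (nterm N p.2)) *+ 2 + e].
Proof.
elim: l e => [|[i j] l IH] e e0.
  exists (fun _ _ => false); split=> // [v|].
    rewrite /bd big1 //; apply/esym/existsP => -[i].
    by rewrite /par big_nil andbF.
  rewrite big_nil mul0rn add0r /wt big1 ?(ltW e0) // => x _.
  by rewrite big_pred0.
have e2 : 0 < e / 2 by rewrite divr_gt0.
(* A quarter of the slack for the walk: its chain weighs up to twice its length. *)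
have e4 : 0 < e / 4 by rewrite divr_gt0.
have [z [[zs zn] zb zw]] := IH _ e2.
have [p [pp lp wp]] := near_dist (nterm N i) (nterm N j) e4.
have [z' [[zs' zn'] zb' zw']] := walk_chain pp.
exists (addc z' z); split.
- by split; [exact: addc_sym | exact: addc_sub].
- move=> v; rewrite bd_addc zb zb' lp.
  have [/existsP[m /eqP <-]|nv] := boolP [exists m, nterm N m == v].
    by rewrite !on_termsE {2}/par big_cons /= !(inj_eq nterm_inj).
  have nm m : (nterm N m == v) = false.
    by apply: contraNF nv => h; apply/existsP; exists m.
  by rewrite !nm /on_terms; under eq_existsb do rewrite nm;
    under [in RHS]eq_existsb do rewrite nm; rewrite addFb.
- apply: le_trans (wt_addc zn' zn) _; rewrite big_cons /=.
  move: zw zw' wp; lra.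
Qed.

End NetworkDist.

(** Least joins on terminals depend only on terminal distances: pass to pairs in [N1], then realize
    the pairs by walks in [N2]. It is applied from the dual to the minor with factor [q], and back
    with factor 1. *)
Lemma chain_transfer {R : realType} {k : nat} (N1 N2 : network R k) (q e : R)
    (tau : pred 'I_k) (z1 : rel (nv N1)) :
  is_network N1 -> is_network N2 -> 0 <= q -> 0 < e ->
  (forall i j, dist N2 (nterm N2 i) (nterm N2 j) <=
               q * dist N1 (nterm N1 i) (nterm N1 j)) ->
  is_chain z1 -> bd z1 =1 on_terms tau ->
  exists z2 : rel (nv N2),
    [/\ is_chain z2, bd z2 =1 on_terms tau & wt z2 <= q * wt z1 + e].
Proof.
move=> h1 h2 q0 e0 hq c1 b1.
have [l [parl wl]] := chain_pairs h1 c1 b1.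
have [z2 [c2 b2 w2]] := pairs_chain h2 l e0.
exists z2; split=> // [v|].
  by rewrite b2; apply: eq_existsb => i; rewrite parl.
apply: (le_trans w2); rewrite lerD2r.
apply: le_trans (ler_wpM2l q0 wl).
rewrite mulrnAr lerMn2r /= mulr_sumr; apply: ler_sum => p _; exact: hq.
Qed.

(** * Chains and minors *)

Lemma on_terms_xor {R : realType} {k : nat} (N : network R k) (tau : pred 'I_k) v :
  is_network N ->
  on_terms tau v = \big[addb/false]_i ((nterm N i == v) && tau i).
Proof.
move=> hN; have [/existsP[i /eqP <-]|nv] := boolP [exists i, nterm N i == v].
  rewrite on_termsE // -(xor_pred1 i tau); apply: eq_bigr => j _.
  by rewrite (inj_eq (nterm_inj hN)).
have nm m : (nterm N m == v) = false.
  by apply: contraNF nv => h; apply/existsP; exists m.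
rewrite big1 => [|i _]; last by rewrite nm.
by apply/existsP => -[i]; rewrite nm.
Qed.

Section Minor.
Context {R : realType} {k : nat} (N M : network R k).
Hypothesis (hN : is_network N) (hM : is_network M).
Variable beta : nv M -> {set nv N}.

Definition inside (U : {set nv N * nv N}) (u : nv M) : rel (nv N) :=
  [rel a b | [&& (a, b) \in U, a \in beta u & b \in beta u]].

(* A minimal [U] has exactly one edge per edge of [M] and is a forest inside each
   branch set. *)
Definition realizes (U : {set nv N * nv N}) : Prop :=
  [/\ forall x y, (x, y) \in U -> nadj N x y,
      forall x y, (x, y) \in U -> (y, x) \in U,
      forall u x y, x \in beta u -> y \in beta u -> connect (inside U u) x y &
      forall u v, nadj M u v ->
        exists x, exists y, [/\ x \in beta u, y \in beta v & (x, y) \in U]].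

Hypothesis beta_conn : forall u x y, x \in beta u -> y \in beta u ->
  connect [rel a b | [&& nadj N a b, a \in beta u & b \in beta u]] x y.
Hypothesis beta_disj : forall u v, u != v -> [disjoint beta u & beta v].
Hypothesis beta_adj : forall u v, nadj M u v ->
  exists x, exists y, [/\ x \in beta u, y \in beta v & nadj N x y].
Hypothesis beta_ne : forall u, beta u != set0.
Hypothesis beta_term : forall i, nterm N i \in beta (nterm M i).

Lemma beta_inj u v x : x \in beta u -> x \in beta v -> u = v.
Proof.
move=> xu xv; apply/eqP; apply: contraTT xv => /beta_disj/disjointFr.
by move=> /(_ x xu) ->.
Qed.

Lemma exists_minimal_realization : exists U, realizes U /\
  forall U', realizes U' -> U' \subset U -> U' = U.
Proof.
have [|U /minsetP[/asboolP gU minU]] := @ex_minset _ (fun U => `[< realizes U >]).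
  exists [set p | nadj N p.1 p.2]; apply/asboolP; split.
  - by move=> x y; rewrite inE.
  - by move=> x y; rewrite !inE /= nadj_sym.
  - move=> u x y xu yu; apply: etrans (beta_conn xu yu); apply: eq_connect.
    by move=> a b; rewrite /inside /= inE.
  - by move=> u v /beta_adj[x [y [? ? ?]]]; exists x, y; rewrite inE.
by exists U; split=> // U' gU'; apply: minU; apply/asboolP.
Qed.

Variable U : {set nv N * nv N}.
Hypothesis U_real : realizes U.
Hypothesis U_min : forall U', realizes U' -> U' \subset U -> U' = U.

Let U_adj x y : (x, y) \in U -> nadj N x y. Proof. by case: U_real => h _ _ _ /h. Qed.
Let U_symW x y : (x, y) \in U -> (y, x) \in U. Proof. by case: U_real => _ h _ _ /h. Qed.
Let U_sym x y : ((x, y) \in U) = ((y, x) \in U). Proof. by apply/idP/idP => /U_symW. Qed.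

Definition without x y : {set nv N * nv N} := U :\: [set (x, y); (y, x)].

Let inside_sym x y u : symmetric (inside (without x y) u).
Proof.
move=> a b; rewrite /inside /= !inE U_sym !xpair_eqE.
by rewrite orbC [in RHS]andbA [in RHS]andbAC -[in RHS]andbA; congr (~~ (_ || _) && _ && _);
  rewrite andbC.
Qed.

(** An edge that is neither a bridge of its branch set nor the only link between two adjacent branch
    sets could be deleted, in both orientations, against minimality. *)
Lemma minimal_edge x y : (x, y) \in U ->
  (exists u, [/\ x \in beta u, y \in beta u & ~~ connect (inside (without x y) u) x y]) \/
  (exists u v, [/\ nadj M u v, x \in beta u, y \in beta v & forall x' y',
     x' \in beta u -> y' \in beta v -> (x', y') \in U -> (x', y') = (x, y)]).
Proof.
move=> xyU; apply: contrapT => /not_orP[na nb].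
suff /U_min/(_ (subsetDl _ _)) E : realizes (without x y).
  by have := xyU; rewrite -E !inE eqxx.
split.
- by move=> a b; rewrite inE => /andP[_ /U_adj].
- by move=> a b; rewrite !inE !xpair_eqE U_sym orbC [X in X || _]andbC [X in _ || X]andbC.
- case: (U_real) => _ _ conn _ u a b au bu; move: (conn u a b au bu).
  apply: connect_sub => {au bu}a {}b /and3P[abU au bu].
  have [abE|abE] := boolP ((a, b) \in [set (x, y); (y, x)]); last first.
    by apply: connect1; rewrite /inside /= au bu inE abE abU.
  have xyc : x \in beta u -> y \in beta u -> connect (inside (without x y) u) x y.
    by move=> xu yu; apply/negPn/negP => nc; apply: na; exists u.
  move: abE au bu; rewrite !inE !xpair_eqE => /orP[]/andP[/eqP-> /eqP->] au bu.
    exact: xyc.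
  by rewrite (sym_connect_sym (inside_sym x y u)); exact: xyc.
- have key u v a b : nadj M u v -> a \in beta u -> b \in beta v ->
      (a, b) = (x, y) -> exists a' b', [/\ a' \in beta u, b' \in beta v &
        (a', b') \in without x y].
    move=> uv au bv abE; apply: contrapT => nex; apply: nb; exists u, v.
    case: abE (au) (bv) => -> -> xu yv; split=> // a' b' a'u b'v abU.
    apply/eqP; apply: contrapT => /negP abxy; apply: nex; exists a', b'.
    split=> //; rewrite !inE abU andbT negb_or abxy /=.
    apply: contraTneq uv => -[a'y b'x].
    by rewrite (beta_inj xu (v := v)) ?nadj_irr // -b'x.
  move=> u v uv; case: (U_real) => _ _ _ /(_ u v uv)[a [b [au bv abU]]].
  have [abE|abE] := boolP ((a, b) \in [set (x, y); (y, x)]); last first.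
    by exists a, b; rewrite inE abE.
  move: abE; rewrite !inE => /orP[/eqP|/eqP abE]; first exact: key.
  have vu : nadj M v u by rewrite nadj_sym.
  have [|b' [a' [b'v a'u h]]] := key v u b a vu bv au.
    by case: abE => -> ->.
  exists a', b'; split=> //; move: h; rewrite !inE !xpair_eqE U_sym orbC.
  by rewrite [X in X || _]andbC [X in _ || X]andbC.
Qed.

Lemma U_branch x y : (x, y) \in U -> exists u, x \in beta u.
Proof. by case/minimal_edge => [[u []]|[u [v []]]]; exists u. Qed.

Lemma U_adjM x y u v : (x, y) \in U -> x \in beta u -> y \in beta v -> u != v ->
  nadj M u v.
Proof.
move=> /minimal_edge[[w [xw yw _]] xu yv|[u' [v' [uv xu' yv' _]] xu yv _]].
  by rewrite (beta_inj xu xw) (beta_inj yv yw) eqxx.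
by rewrite (beta_inj xu xu') (beta_inj yv yv').
Qed.

Lemma U_uniq x y x' y' u v : (x, y) \in U -> (x', y') \in U -> x \in beta u ->
  y \in beta v -> x' \in beta u -> y' \in beta v -> u != v -> (x', y') = (x, y).
Proof.
move=> /minimal_edge[[w [xw yw _]] _ xu yv|[u' [v' [_ xu' yv' h]] xyU xu yv x'u y'v _]].
  by rewrite (beta_inj xu xw) (beta_inj yv yw) eqxx.
by apply: h => //; rewrite -?(beta_inj xu xu') -?(beta_inj yv yv').
Qed.

Lemma U_forest x y u : (x, y) \in U -> x \in beta u -> y \in beta u ->
  ~~ connect (inside (without x y) u) x y.
Proof.
move=> /minimal_edge[[w [xw yw nc]] xu _|[u' [v' [uv xu' yv' _]] xu yu]].
  by rewrite (beta_inj xu xw).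
by move: uv; rewrite -(beta_inj xu xu') -(beta_inj yu yv') nadj_irr.
Qed.

(** * Projecting chains inside [U] to the minor, and lifting them back *)

Definition in_U (z : rel (nv N)) := forall x y, z x y -> (x, y) \in U.

(** For [z] inside [U] the double sum has at most one nonzero term; writing it as a sum lets
    boundaries be computed by exchanging sums. *)
Definition proj (z : rel (nv N)) : rel (nv M) := fun u v =>
  (u != v) && \big[addb/false]_(x in beta u) \big[addb/false]_(y in beta v) z x y.

Lemma projE (z : rel (nv N)) x y u v : in_U z -> (x, y) \in U ->
  x \in beta u -> y \in beta v -> u != v -> proj z u v = z x y.
Proof.
move=> zU xyU xu yv nuv; rewrite /proj nuv /= (bigD1 x) //= (bigD1 y) //=.
rewrite big1 => [|y' /andP[y'v ny']]; last first.
  apply: contraNF ny' => /zU xy'U.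
  by have [->] := U_uniq xyU xy'U xu yv xu y'v nuv.
rewrite big1 ?addbF // => x' /andP[x'u nx']; rewrite big1 // => y' y'v.
apply: contraNF nx' => /zU xy'U.
by have [->] := U_uniq xyU xy'U xu yv x'u y'v nuv.
Qed.

Lemma proj_ex (z : rel (nv N)) u v : proj z u v ->
  exists x y, [/\ x \in beta u, y \in beta v & z x y].
Proof.
case/andP=> _ h; apply: contrapT => nex; move: h.
rewrite big1 // => x xu; rewrite big1 // => y yv; apply: contra_notF nex => zxy.
by exists x, y.
Qed.

Lemma proj_chain (z : rel (nv N)) : symmetric z -> in_U z -> is_chain (proj z).
Proof.
move=> zs zU; split=> [u v|u v].
  rewrite /proj eq_sym exchange_big /=; congr (_ && _).
  by apply: eq_bigr => x _; apply: eq_bigr => y _; rewrite zs.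
move=> puv; have [x [y [xu yv /zU xyU]]] := proj_ex puv.
by apply: U_adjM xyU xu yv _; case/andP: puv.
Qed.

(** Edges of [z] inside the branch set cancel. Those leaving it end in another branch set, since
    every end of an edge of a minimal [U] lies in one. *)
Lemma bd_proj (z : rel (nv N)) u : symmetric z -> in_U z ->
  bd (proj z) u = \big[addb/false]_(x in beta u) bd z x.
Proof.
move=> zs zU; have zi : irreflexive z.
  by move=> x; apply/negP => /zU/U_adj; rewrite nadj_irr.
rewrite (xor_bd_cut (mem (beta u))) // /bd /proj.
transitivity (\big[addb/false]_(v | u != v) \big[addb/false]_(x in beta u)
    \big[addb/false]_(y in beta v) z x y).
  by rewrite [RHS]big_mkcond; apply: eq_bigr => v _; case: eqP.
rewrite exchange_big /=; apply: eq_bigr => x xu.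
rewrite (exchange_big_dep xpredT) //= [RHS]big_mkcond; apply: eq_bigr => y _ /=.
case zxy: (z x y); last by rewrite big1_eq; case: ifP.
have [w yw] : exists w, y \in beta w by apply: U_branch (zU y x _); rewrite zs.
have [wu|wu] := eqVneq u w.
  rewrite wu yw /= big_pred0 // => v; apply/negP => /andP[+ yv].
  by rewrite (beta_inj yv yw) eqxx.
rewrite (_ : y \notin beta u) => [|]; last first.
  by apply: contra_neqN wu => yu; exact: beta_inj yu yw.
rewrite (big_pred1 w) // => v; apply/andP/eqP => [[_ yv]|->//].
exact: beta_inj yv yw.
Qed.

Lemma bd_proj_terms (z : rel (nv N)) tau : symmetric z -> in_U z ->
  bd z =1 on_terms tau -> bd (proj z) =1 on_terms tau.
Proof.
move=> zs zU zb u; rewrite bd_proj //.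
under eq_bigr => x _ do rewrite zb on_terms_xor //.
rewrite exchange_big on_terms_xor //=; apply: eq_bigr => i _.
under eq_bigr => x _ do rewrite eq_sym.
rewrite big_mkcond /= (eq_bigr (fun x => (x == nterm N i) && ((x \in beta u) && tau i))).
  rewrite xor_pred1; congr (_ && _); apply/idP/eqP => [h|<-//].
  exact: beta_inj (beta_term i) h.
by move=> x _; case: ifP; rewrite ?andbF.
Qed.

(** Branch sets are disjoint, so the sum has at most one term: the weight of the edge of [M] that
    [(x, y)] realizes, and zero inside a branch set. *)
Definition kappa x y : R := if (x, y) \in U then
  \sum_(u | x \in beta u) \sum_(v | (u != v) && (y \in beta v)) nw M u v else 0.

Lemma kappa_ge0 x y : 0 <= kappa x y.
Proof.
rewrite /kappa; case: ifP => // xyU; apply: sumr_ge0 => u xu; apply: sumr_ge0 => v.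
by case/andP=> uv yv; apply: nw_ge0 => //; exact: U_adjM xyU xu yv uv.
Qed.

Lemma wt_proj (z : rel (nv N)) : symmetric z -> in_U z ->
  wt (proj z) = \sum_x \sum_(y | z x y) kappa x y.
Proof.
move=> zs zU; transitivity (\sum_x \sum_(y | z x y)
    \sum_(u | x \in beta u) \sum_(v | (u != v) && (y \in beta v)) nw M u v); last first.
  by apply: eq_bigr => x _; apply: eq_bigr => y /zU; rewrite /kappa => ->.
transitivity (\sum_x \sum_(u | x \in beta u) \sum_(v | u != v)
    \sum_(y | z x y && (y \in beta v)) nw M u v); last first.
  apply: eq_bigr => x _; rewrite [RHS]exchange_big /=; apply: eq_bigr => u _.
  rewrite [RHS](exchange_big_dep (fun v => u != v)) /=; last by move=> y v _ /andP[].
  by apply: eq_bigr => v uv; apply: eq_bigl => y; rewrite uv.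
rewrite (exchange_big_dep xpredT) //=; apply: eq_bigr => u _.
rewrite exchange_big /= big_mkcond /= [RHS]big_mkcond.
apply: eq_bigr => v _; case: (boolP (u != v)) => uv; last by rewrite /proj (negbTE uv).
case: ifP => [puv|puv].
  have [x [y [xu yv zxy]]] := proj_ex puv.
  rewrite (bigD1 x) //= (big_pred1 y) => [|y']; last first.
    apply/andP/eqP => [[zxy' yv']|->]; last by rewrite zxy yv.
    by have [] := U_uniq (zU _ _ zxy) (zU _ _ zxy') xu yv xu yv' uv.
  rewrite big1 ?addr0 // => x' /andP[xu' /negP nx]; rewrite big_pred0 // => y'.
  apply/negP => /andP[zxy' yv']; apply: nx.
  by have [-> _] := U_uniq (zU _ _ zxy) (zU _ _ zxy') xu yv xu' yv' uv.
rewrite big1 // => x xu; rewrite big_pred0 // => y; apply/negP => /andP[zxy yv].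
by move: puv; rewrite (projE zU (zU _ _ zxy) xu yv uv) zxy.
Qed.

(** With an empty projection [z] would never leave a branch set, and there [x y] is a bridge of [U].
    It would be the only edge of [z] leaving the side of [x], whereas an even chain leaves every
    vertex set an even number of times. *)
Lemma proj_neq0 (z : rel (nv N)) x y : symmetric z -> in_U z ->
  bd z =1 xpred0 -> z x y -> exists u v, proj z u v.
Proof.
move=> zs zU zb zxy; apply: contrapT => np.
have zi : irreflexive z by move=> a; apply/negP => /zU/U_adj; rewrite nadj_irr.
have zin a b u : z a b -> a \in beta u -> b \in beta u.
  move=> zab au.
  have [v bv] : exists v, b \in beta v by apply: U_branch (zU b a _); rewrite zs.
  have [->//|uv] := eqVneq u v; case: np; exists u, v.
  by rewrite (projE zU (zU _ _ zab) au bv uv).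
have [u xu] := U_branch (zU _ _ zxy); have yu := zin _ _ _ zxy xu.
have := U_forest (zU _ _ zxy) xu yu; set e := inside _ u => nxy.
pose B a := connect e x a.
have Bbeta a : B a -> a \in beta u.
  case/connectP=> p; case: p => [_ ->//|b p]; elim/last_ind: p => [|p c _] /=.
    by rewrite andbT => /and3P[_ _ bu] ->.
  rewrite rcons_path last_rcons => /and3P[_ _ /and3P[_ _ cu]] -> //.
have := xor_bd_cut B zs zi; rewrite big1 => [|a _]; last by rewrite zb.
rewrite (bigD1 x) ?/B ?connect0 //= (bigD1 y) //= zxy.
rewrite big1 => [|b /andP[nb nby]]; last first.
  apply: contraNF nb => zxb; apply: connect1; rewrite /e /inside /= xu (zin _ _ _ zxb xu).
  rewrite !inE zU // !xpair_eqE eqxx (negbTE nby) /= negb_and !andbT.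
  by apply/orP; right; apply: contraTneq zxb => ->; rewrite zi.
rewrite big1 // => a /andP[Ba nax]; rewrite big1 // => b nBb.
apply: contraNF nBb => zab; have au := Bbeta _ Ba.
apply: (connect_trans Ba); apply: connect1; rewrite /e /inside /= au (zin _ _ _ zab au).
rewrite !inE zU // !xpair_eqE (negbTE nax) /= negb_and !andbT.
by apply/orP; left; apply: contraTneq Ba => ->.
Qed.

(** Take the edges of [U] over the edges of [Z]. Inside a branch set the resulting boundary has the
    parity of [bd Z u]; after toggling the terminal where [bd Z u] holds it is even, so a chain
    inside the connected branch set corrects it without affecting the projection. *)
Lemma lift_chain (Z : rel (nv M)) tau : is_chain Z -> bd Z =1 on_terms tau ->
  exists z : rel (nv N),
    [/\ symmetric z, in_U z, bd z =1 on_terms tau & proj z =2 Z].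
Proof.
move=> [Zs Zn] Zb.
(* [rep u] is the terminal of [N] if [u] is a terminal of [M]. Otherwise it is any vertex of the
   branch set, and nothing is toggled there because [bd Z u] is false. *)
have /choice[rep repP] u : exists x, x \in beta u /\
    forall i, nterm M i = u -> x = nterm N i.
  case: (pickP (fun i => nterm M i == u)) => [i /eqP <-|nt].
    by exists (nterm N i); split=> // j /(nterm_inj hM) ->.
  have /set0Pn[x xu] := beta_ne u; exists x; split=> // i iu.
  by have := nt i; rewrite iu eqxx.
pose z0 x y := ((x, y) \in U) &&
  [exists u, exists v, [&& x \in beta u, y \in beta v & Z u v]].
have z0s : symmetric z0.
  move=> x y; rewrite /z0 U_sym; congr (_ && _).
  by apply/existsP/existsP => -[u /existsP[v /and3P[? ? ?]]]; exists v;
    apply/existsP; exists u; apply/and3P; split=> //; rewrite Zs.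
have z0U : in_U z0 by move=> x y /andP[].
have z0p : proj z0 =2 Z.
  move=> u v; have [<-|uv] := eqVneq u v.
    by rewrite /proj eqxx (chain_irr hM Zn).
  apply/idP/idP => [puv|Zuv].
    have [x [y [xu yv /andP[_ /existsP[u' /existsP[v' /and3P[xu' yv' Zuv]]]]]]] := proj_ex puv.
    by rewrite (beta_inj xu xu') (beta_inj yv yv').
  case: U_real => _ _ _ /(_ u v (Zn _ _ Zuv))[x [y [xu yv xyU]]].
  rewrite (projE z0U xyU xu yv uv) /z0 xyU.
  by apply/existsP; exists u; apply/existsP; exists v; rewrite xu yv.
have /choice[F FP] u : exists zu : rel (nv N), [/\ symmetric zu, subrel zu (inside U u) &
    bd zu =1 (fun x => (x \in beta u) && (bd z0 x (+) ((x == rep u) && bd Z u)))].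
  apply: (@even_set_chain _ _ (mem (beta u))).
  - by move=> a b; rewrite /inside /= U_sym; case: (a \in _); case: (b \in _).
  - by move=> a; apply/negP => /and3P[/U_adj]; rewrite nadj_irr.
  - by case: U_real => _ _ h _ a b; apply: h.
  - by move=> x /andP[].
  - rewrite (eq_bigr (fun x => ((x \in beta u) && bd z0 x) (+)
        ((x == rep u) && ((x \in beta u) && bd Z u)))); last first.
      by move=> x _; case: (x \in beta u); rewrite /= ?andbF.
    rewrite big_split /= xor_pred1 (proj1 (repP u)) /=.
    transitivity (bd (proj z0) u (+) bd Z u).
      rewrite bd_proj // [in RHS]big_mkcond /=; congr (_ (+) _).
    rewrite (_ : bd (proj z0) u = bd Z u) ?addbb //.
    by apply: eq_bigr => v _; rewrite z0p.
pose z1 x y := \big[addb/false]_u F u x y.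
have z1E x y : z1 x y -> exists u, inside U u x y.
  move=> h; apply: contrapT => nex; move: h; rewrite /z1 big1 // => u _.
  apply: contra_notF nex => Fxy; exists u; case: (FP u) => _ sub _; exact: sub.
exists (addc z0 z1).
have zs : symmetric (addc z0 z1).
  by apply: addc_sym => // x y; apply: eq_bigr => u _; case: (FP u).
have zU : in_U (addc z0 z1).
  move=> x y; rewrite /addc; case E: (z0 x y); first by move=> _; exact: z0U.
  by case/z1E => u /and3P[].
split=> //.
  move=> x; rewrite bd_addc {2}/bd /z1 exchange_big /=.
  have FE u : \big[addb/false]_y F u x y =
      (x \in beta u) && (bd z0 x (+) ((x == rep u) && bd Z u)).
    by case: (FP u) => _ _ <-.
  rewrite (eq_bigr _ (fun u _ => FE u)).
  have [[u xu]|nx] := pselect (exists u, x \in beta u); last first.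
    rewrite big1 ?addbF => [|u _]; last first.
      by apply/andP => -[xu _]; apply: nx; exists u.
    transitivity false.
      rewrite /bd big1 // => y _; apply: contra_notF nx => /z0U; exact: U_branch.
    apply/esym/existsP => -[i /andP[/eqP ix _]]; apply: nx.
    by exists (nterm M i); rewrite -ix.
  rewrite (bigD1 u) //= xu big1 ?addbF /=; last first.
    move=> v vu; apply/negP => /andP[xv _].
    by move: vu; rewrite (beta_inj xv xu) eqxx.
  rewrite addbA addbb addFb Zb; apply/andP/existsP.
    move=> [/eqP -> /existsP[i /andP[/eqP iu ti]]]; exists i.
    by rewrite ti andbT eq_sym; apply/eqP/(proj2 (repP u)).
  move=> [i /andP[/eqP ix ti]]; have iu : nterm M i = u.
    by apply: beta_inj xu; rewrite -ix.
  by rewrite (proj2 (repP u) i iu) ix -iu on_termsE.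
move=> u v; rewrite -z0p /proj; case: (eqVneq u v) => //= uv.
apply: eq_bigr => x xu; apply: eq_bigr => y yv.
rewrite /addc (_ : z1 x y = false) ?addbF //; apply/negP => /z1E[w /and3P[_ xw yw]].
by move: uv; rewrite (beta_inj xu xw) (beta_inj yv yw) eqxx.
Qed.

End Minor.

(** * Splitting a cycle of a permutation *)

Section Perm.
Context {D : finType}.
Implicit Types s t r : {perm D}.
Local Open Scope group_scope.

Lemma porbit_trans s (x y z : D) :
  x \in porbit s y -> y \in porbit s z -> x \in porbit s z.
Proof. by rewrite -!eq_porbit_mem => /eqP->. Qed.

Lemma porbit_step s x : s x \in porbit s x.
Proof. exact: (mem_porbit s 1). Qed.

Lemma porbit_fixed s x (T : Type) (g : D -> T) y :
  (forall d, g (s d) = g d) -> y \in porbit s x -> g y = g x.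
Proof.
move=> gs /porbitP[i ->]; elim: i => [|i IH]; first by rewrite perm1.
by rewrite expgSr permM gs.
Qed.

Lemma sub_porbit s r : (forall d, s d \in porbit r d) ->
  forall x y, x \in porbit s y -> x \in porbit r y.
Proof.
move=> h x y /porbitP[i ->]; elim: i => [|i IH]; first by rewrite perm1 porbit_id.
by rewrite expgSr permM; exact: porbit_trans (h _) IH.
Qed.

Lemma mem_porbit_perm s x y : (s x \in porbit s y) = (x \in porbit s y).
Proof.
apply/idP/idP; apply: porbit_trans; last exact: porbit_step.
by rewrite porbit_sym porbit_step.
Qed.

Lemma card_porbits_tperm s x y :
  (#|porbits (s * tperm x y)| + (x \notin porbit s y).*2 = #|porbits s| + (x != y))%N.
Proof.
rewrite -porbitsV invMg tpermV -(porbitsV s) -(porbitV s y).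
exact: porbits_mul_tperm.
Qed.

Lemma merge_porbits r x y : x \notin porbit r y ->
  let r1 := r * tperm x y in
  [/\ (#|porbits r1| + 1 = #|porbits r|)%N, x \in porbit r1 y &
      forall u v, u \in porbit r v -> u \in porbit r1 v].
Proof.
move=> nxy r1; have xy : x != y by apply: contraNneq nxy => ->; exact: porbit_id.
have E1 := card_porbits_tperm r x y; rewrite -/r1 nxy xy /= in E1.
have E2 := card_porbits_tperm r1 x y.
rewrite /r1 -mulgA tperm2 mulg1 -/r1 xy in E2.
have xr1 : x \in porbit r1 y.
  by apply: contraT => nx; rewrite nx /= in E2; lia.
split=> //; first by lia.
apply: sub_porbit => d; have := porbit_step r1 d; rewrite {1}/r1 permM.
case: tpermP => // ->; first exact: porbit_trans.
by apply: porbit_trans; rewrite porbit_sym.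
Qed.

(** A transposition splits a cycle containing both points and merges two cycles containing one each.
    Every step thus gains a cycle of [s] and loses one of [r]. The invariant [lab] certifies that
    the points of [A] lie in distinct cycles of [r]. For a map, [s] permutes along faces and [r]
    around vertices. *)
Lemma split_porbit n (A : {set D}) s r x (T : eqType) (lab : D -> T) :
  #|A| = n -> x \in A -> {in A, forall z, z \in porbit s x} ->
  (forall d, lab (r d) = lab d) -> {in A &, injective lab} ->
  exists sg : {perm D},
   [/\ perm_on A sg,
       {in A &, forall u v, u \in porbit (s * sg) v -> u = v},
       {in A &, forall u v, u \in porbit (r * sg) v},
       forall u v, u \in porbit r v -> u \in porbit (r * sg) v &
       (#|porbits (s * sg)| + #|porbits (r * sg)| = #|porbits s| + #|porbits r|)%N].
Proof.
elim: n A s r x lab => [|n IH] A s r x lab cA xA As labr labA.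
  by rewrite (cards0_eq cA) inE in xA.
have [A1|[z0 z0A z0x]] : A = [set x] \/ exists2 z0, z0 \in A & z0 != x.
  case: (pickP (fun z => (z \in A) && (z != x))) => [z0 /andP[]|h].
    by right; exists z0.
  left; apply/setP => z; rewrite inE; apply/idP/eqP => [zA|->//].
  by have := h z; rewrite zA => /negbT; rewrite negbK => /eqP.
  exists 1; rewrite !mulg1; split=> //; first exact: perm_on1.
    by move=> u v; rewrite A1 !inE => /eqP-> /eqP->.
  by move=> u v; rewrite A1 !inE => /eqP-> /eqP->; exact: porbit_id.
pose L := #|porbit s x|.
have powx i : (0 < i < L)%N -> (s ^+ i) x != x.
  move=> /andP[i0 iL]; have := uniq_traject_porbit s x; rewrite -/L => u.
  have L0 : (0 < L)%N by exact: leq_ltn_trans iL.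
  have : nth x (traject s x L) i != nth x (traject s x L) 0.
    by rewrite nth_uniq ?size_traject // -lt0n.
  by rewrite !nth_traject // permX.
have inA z : z \in A -> z != x -> exists i, (0 < i < L)%N /\ z = (s ^+ i) x.
  move=> zA zx; have := As z zA; rewrite porbit_traject => /trajectP[i iL zi].
  exists i; rewrite iL andbT permX; split=> //.
  by case: i zi {iL} => // E; rewrite E /= eqxx in zx.
have exm : exists m, (0 < m)%N && ((s ^+ m) x \in A).
  by have [i [/andP[i0 _] E]] := inA z0 z0A z0x; exists i; rewrite i0 -E.
(* [y] is the first point of [A] after [x] on the cycle, so the transposition cuts off an arc whose
   only point of [A] is [x]. *)
have [m /andP[m0 yA] minm] := ex_minnP exm; set y := (s ^+ m) x in yA.
have mL : (m < L)%N.
  have [i [/andP[i0 iL] E]] := inA z0 z0A z0x.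
  by apply: leq_ltn_trans iL; apply: minm; rewrite i0 -E.
have yx : y != x by apply: powx; rewrite m0.
have xy : x != y by rewrite eq_sym.
pose t := tperm x y; pose s1 := s * t; pose r1 := r * t.
have cs := card_porbits_tperm s x y.
rewrite -/t -/s1 porbit_sym mem_porbit xy addn0 /= in cs.
have nxs1 : x \notin porbit s1 y.
  have := card_porbits_tperm s1 x y; rewrite -/t /s1 -mulgA tperm2 mulg1 -/s1 xy.
  by case: (x \in _) => //=; lia.
have nxr : x \notin porbit r y.
  apply: contraNN xy => /(porbit_fixed labr) E; apply/eqP; exact: labA.
have [cr xr1 subr] := merge_porbits nxr; rewrite -/t -/r1 in cr xr1 subr.
have A1s1 : {in A :\ x, forall z, z \in porbit s1 y}.
  move=> z; rewrite !inE => /andP[zx zA]; have [i [/andP[i0 iL] zi]] := inA z zA zx.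
  have mi : (m <= i)%N by apply: minm; rewrite i0 -zi.
  have iterE j : (m + j < L)%N -> (s1 ^+ j) y = (s ^+ (m + j)) x.
    elim: j => [|j IHj] jL; first by rewrite addn0 perm1.
    rewrite expgSr permM IHj; last by apply: leq_ltn_trans jL; rewrite leq_add2l.
    rewrite /s1 permM -[s _]permM -expgSr -addnS tpermD //.
      by rewrite eq_sym powx // jL andbT addnS.
    have j1L : (0 < j.+1 < L)%N by rewrite (leq_ltn_trans _ jL) // leq_addl.
    apply: contraNneq (powx _ j1L) => E; apply/eqP/(@perm_inj _ (s ^+ m)).
    by rewrite -permM -expgD addnC -E.
  by rewrite zi -(subnKC mi) -iterE ?subnKC // mem_porbit.
(* The merged cycle of [r1] receives a single label. *)
pose lab1 d := if lab d == lab x then lab y else lab d.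
have cA1 : #|A :\ x| = n by have := cardsD1 x A; rewrite xA cA; lia.
have yA1 : y \in A :\ x by rewrite !inE yx.
have lab1r d : lab1 (r1 d) = lab1 d.
  rewrite /r1 permM -[in RHS]/(lab1 _) /lab1 -[in RHS](labr d).
  case: tpermP => [->|->|//]; rewrite eqxx //; last by case: ifP => // _; rewrite if_same.
  by rewrite (inj_in_eq labA) // (negbTE yx).
have lab1A : {in A :\ x &, injective lab1}.
  move=> u v; rewrite !inE => /andP[ux uA] /andP[vx vA]; rewrite /lab1.
  by rewrite !(inj_in_eq labA) // (negbTE ux) (negbTE vx); exact: labA.
have [sg [sgA dis mer sub cnt]] := IH _ s1 r1 y lab1 cA1 yA1 A1s1 lab1r lab1A.
exists (t * sg); rewrite !mulgA -/s1 -/r1; split.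
- apply: perm_onM.
    apply: (subset_trans (tperm_on x y)); apply/subsetP => u.
    by rewrite !inE => /orP[]/eqP->.
  by apply: (subset_trans sgA); exact: subsetDl.
(* The points moved by [sg] all lie off the [s1]-cycle of [x], so this cycle is unchanged. *)
- have disx v : v \in A :\ x -> v \notin porbit (s1 * sg) x.
    move=> vA; apply: (contraNN _ nxs1) => /porbitP[j vj].
    have vs1 : v \in porbit s1 x.
      rewrite vj; elim: j {vj} => [|j IHj]; first by rewrite perm1 porbit_id.
      rewrite expgSr permM permM (out_perm sgA).
        by rewrite mem_porbit_perm.
      apply: (contraNN _ nxs1) => /A1s1; apply: porbit_trans.
      by rewrite porbit_sym mem_porbit_perm.
    by apply: porbit_trans (A1s1 v vA); rewrite porbit_sym.
  move=> u v uA vA; have [->|ux] := eqVneq u x; have [->|vx] := eqVneq v x => //.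
  + by rewrite porbit_sym (negbTE (disx v _)) // !inE vx.
  + by rewrite (negbTE (disx u _)) // !inE ux.
  + by apply: dis; rewrite !inE ?ux ?vx.
- have xy' : x \in porbit (r1 * sg) y by exact: sub.
  have toy u : u \in A -> u \in porbit (r1 * sg) y.
    move=> uA; have [->//|ux] := eqVneq u x.
    by apply: mer; rewrite !inE ?ux ?yx.
  by move=> u v /toy uy /toy; rewrite porbit_sym; exact: porbit_trans.
- by move=> u v /subr /sub.
- by rewrite cnt cs -cr -addnA [(1 + _)%N]addnC.
Qed.

End Perm.

(** * Cut-cycle duality of spherical maps *)

Section Duality.
Context {V D : finType}.
Variables (tail : D -> V) (al s : {perm D}).
Hypothesis alK : forall d, al (al d) = d.
Hypothesis al_neq : forall d, al d != d.
Hypothesis tail_s : forall d, tail (s d) = tail (al d).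
Hypothesis tail_star : forall d d', tail d = tail d' -> d' \in porbit (al * s)%g d.
Hypothesis map_conn : forall chi : pred V,
  (forall d, chi (tail d) = chi (tail (al d))) -> forall u v, chi u = chi v.

(** Such a [g] is constant around each vertex, so it descends to a predicate on vertices that is
    constant along edges. *)
Lemma dart_conn (g : pred D) : (forall d, g (s d) = g d) -> (forall d, g (al d) = g d) ->
  forall d d', g d = g d'.
Proof.
move=> gs ga; pose chi v := [exists d, (tail d == v) && g d].
have chiE d : chi (tail d) = g d.
  apply/existsP/idP => [[d' /andP[/eqP /tail_star E gd']]|gd]; last first.
    by exists d; rewrite eqxx.
  rewrite (porbit_fixed _ E) // => d0.
  by rewrite permM gs ga.
move=> d d'; rewrite -!chiE; apply: map_conn => d0.
by rewrite !chiE ga.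
Qed.

Definition cutfun (chi : pred V) : {ffun D -> bool} :=
  [ffun d => chi (tail d) (+) chi (tail (al d))].

Lemma sum_invariant_s (g F : pred D) : (forall d, g (s d) = g d) ->
  \big[addb/false]_d (g d && F (s d)) = \big[addb/false]_d (g d && F d).
Proof.
move=> gs; rewrite [RHS](reindex_inj (@perm_inj _ s)) /=.
by apply: eq_bigr => d _; rewrite gs.
Qed.

(** [Sym] encodes the edge sets, [os] is the parity on a face, and [Z] is the cycle space of the
    dual. *)
Let Sym : {set {ffun D -> bool}} :=
  [set f : {ffun D -> bool} | [forall d, f (al d) == f d]].
Let os (f : {ffun D -> bool}) (X : {set D}) := \big[addb/false]_d ((d \in X) && f d).
Let Z : {set {ffun D -> bool}} := [set f in Sym | [forall X in porbits s, ~~ os f X]].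

Let SymP (f : {ffun D -> bool}) : reflect (forall d, f (al d) = f d) (f \in Sym).
Proof. by rewrite inE; apply: (iffP forallP) => h d; apply/eqP. Qed.

Let xorf (f g : {ffun D -> bool}) : {ffun D -> bool} := [ffun d => f d (+) g d].

Let os_xor f g X : os (xorf f g) X = os f X (+) os g X.
Proof. by rewrite /os -big_split; apply: eq_bigr => d _ /=; rewrite ffunE; case: (d \in X). Qed.

(** One edge set is read off the darts preceding their reversal, another off the remaining darts,
    and both can be recovered. This bounds the number of edge sets by 2 to the number of edges,
    without a type of edges. *)
Let card_Sym : (#|Sym| * #|Sym| <= 2 ^ #|D|)%N.
Proof.
pose lt d := (enum_rank d < enum_rank (al d))%N.
have lt_al d : lt (al d) = ~~ lt d.
  rewrite /lt alK; case: (ltngtP (enum_rank d) (enum_rank (al d))) => // E.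
  by have := al_neq d; rewrite -(enum_rank_inj (val_inj E)) eqxx.
pose mix (p : {ffun D -> bool} * {ffun D -> bool}) : {ffun D -> bool} :=
  [ffun d => if lt d then p.1 d else p.2 d].
rewrite -cardsX -(card_in_imset (f := mix)).
  by apply: leq_trans (max_card _) _; rewrite card_ffun card_bool.
move=> [f g] [f' g'] /setXP[/= fS gS] /setXP[/= fS' gS'] E.
have {}E d := congr1 (fun h : {ffun D -> bool} => h d) E.
congr pair; apply/ffunP => d; have := E d; have := E (al d); rewrite !ffunE lt_al /=;
  case: (lt d) => //=.
- by rewrite !(SymP _ fS) !(SymP _ fS').
- by rewrite !(SymP _ gS) !(SymP _ gS').
Qed.

Variable d0 : D.
Let X0 := porbit s d0.

(** A dual path from the face of [d] to that of [d0]: crossing an edge toggles the faces on its two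
    sides. *)
Let sym_path d : exists2 f, f \in Sym &
  forall X, X \in porbits s -> os f X = (d \in X) (+) (d0 \in X).
Proof.
pose C d := `[< exists2 f, f \in Sym &
  forall X, X \in porbits s -> os f X = (d \in X) (+) (d0 \in X)>].
have stepC d1 : C d1 -> C (al d1).
  move=> /asboolP[f fS fE]; apply/asboolP.
  exists (xorf f [ffun e => (e == d1) || (e == al d1)]).
    apply/SymP => e; rewrite !ffunE (SymP _ fS); congr (_ (+) _).
    by rewrite !(can2_eq alK alK) alK orbC.
  move=> X XP; rewrite os_xor fE //.
  have -> : os [ffun e => (e == d1) || (e == al d1)] X = (d1 \in X) (+) (al d1 \in X).
    have inX e : (e \in X) = \big[addb/false]_y ((y == e) && (y \in X)).
      by rewrite (xor_pred1 e (fun y => y \in X)).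
    rewrite (inX d1) (inX (al d1)) -big_split.
    apply: eq_bigr => e _ /=; rewrite ffunE; case: (eqVneq e d1) => [->|_] /=.
      by rewrite eq_sym (negbTE (al_neq d1)) addbF andbT.
    by rewrite andbC.
  by case: (d1 \in X); case: (d0 \in X); case: (al d1 \in X).
have Cd0 : C d0.
  apply/asboolP; exists [ffun=> false]; first by apply/SymP => e; rewrite !ffunE.
  by move=> X _; rewrite addbb /os big1 // => e _; rewrite ffunE andbF.
apply/asboolP; rewrite -/(C d) (@dart_conn C _ _ d d0) // => d1.
  apply/asboolP/asboolP => -[f fS fE]; exists f => // X XP; rewrite fE //;
    case/imsetP: XP => e _ ->; by rewrite mem_porbit_perm.
by apply/idP/idP => /stepC //; rewrite alK.
Qed.

Let sym_faces (Y : {set {set D}}) : Y \subset porbits s :\ X0 ->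
  exists2 f, f \in Sym & forall X, X \in porbits s :\ X0 -> os f X = (X \in Y).
Proof.
move=> YP.
have /choice[F FP] d : exists f, f \in Sym /\ forall X, X \in porbits s ->
    os f X = (d \in X) (+) (d0 \in X).
  by have [f fS fE] := sym_path d; exists f.
have rep (X : {set D}) : exists d, X \in porbits s -> X = porbit s d.
  by case: (boolP (X \in _)) => [/imsetP[d _ ->]|_]; [exists d|exists d0].
have /choice[rp rpP] := rep.
exists [ffun d => \big[addb/false]_(X in Y) F (rp X) d].
  apply/SymP => d; rewrite !ffunE; apply: eq_bigr => X _; apply: SymP.
  by case: (FP (rp X)).
move=> X; rewrite !inE => /andP[X0X XP].
have d0X : (d0 \in X) = false.
  case/imsetP: XP X0X => e _ ->; rewrite /X0; apply: contraNF.
  by rewrite eq_porbit_mem porbit_sym.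
rewrite /os; under eq_bigr => d _ do rewrite ffunE big_distrr /=.
rewrite exchange_big /=.
transitivity (\big[addb/false]_(X' in Y) (X' == X)).
  apply: eq_bigr => X' X'Y; case: (FP (rp X')) => _ /(_ X XP).
  rewrite /os d0X addbF => ->.
  have /andP[_ X'P] : (X' != X0) && (X' \in porbits s).
    by have := subsetP YP X' X'Y; rewrite !inE.
  by case/imsetP: XP => e _ ->; rewrite -eq_porbit_mem -(rpP _ X'P).
rewrite big_mkcond -[RHS](xor_pred1 X (fun X' => X' \in Y)) /=; apply: eq_bigr => X' _.
by rewrite andbC; case: ifP.
Qed.

Hypothesis euler : (2 * #|V| + 2 * #|porbits s| = #|D| + 4)%N.

(** By counting. Write [V], [E], [F] for the numbers of vertices, edges and faces. There are
    [2^(V-1)] cuts, all even on every face. The parities on the faces other than [X0] can be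
    prescribed freely, so at most [2^(E-F+1)] edge sets are even on all faces. Euler's formula makes
    the two numbers equal. *)
Lemma cutcycle_duality (f : pred D) : (forall d, f (al d) = f d) ->
  (forall g : pred D, (forall d, g (s d) = g d) ->
     \big[addb/false]_d (g d && f d) = false) ->
  exists chi : pred V, forall d, f d = chi (tail d) (+) chi (tail (al d)).
Proof.
move=> fal fg.
have porb_inv X : X \in porbits s -> forall d, (s d \in X) = (d \in X).
  by case/imsetP=> e _ -> d; rewrite mem_porbit_perm.
have X0P : X0 \in porbits s by exact: imset_f.
have cardZ : (#|Z| * 2 ^ #|porbits s|.-1 <= #|Sym|)%N.
  have sel (Y : {set {set D}}) : exists g : {ffun D -> bool}, Y \subset porbits s :\ X0 ->
      g \in Sym /\ forall X, X \in porbits s :\ X0 -> os g X = (X \in Y).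
    case: (boolP (Y \subset _)) => [/sym_faces[g gS gE]|_]; first by exists g.
    by exists [ffun=> false].
  have /choice[G GP] := sel.
  pose h (p : {ffun D -> bool} * {set {set D}}) := xorf p.1 (G p.2).
  rewrite -[X in (2 ^ X)%N](_ : #|porbits s :\ X0| = _); last first.
    by have := cardsD1 X0 (porbits s); rewrite X0P; lia.
  rewrite -card_powerset -cardsX -(card_in_imset (f := h)).
    apply: subset_leq_card; apply/subsetP => _ /imsetP[[g Y] /setXP[/= gZ YP] ->].
    move: gZ YP; rewrite inE powersetE => /andP[/SymP gS _] /GP[/SymP GS _].
    by apply/SymP => d; rewrite !ffunE gS GS.
  move=> [g Y] [g' Y'] /setXP[/= gZ YP] /setXP[/= gZ' YP'] E; move: YP YP'.
  rewrite !powersetE => YP YP'.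
  have osZ g1 X : g1 \in Z -> X \in porbits s -> os g1 X = false.
    by rewrite inE => /andP[_ /'forall_implyP h1] /h1/negbTE.
  have YE : Y = Y'.
    apply/setP => X; have [XP|XP] := boolP (X \in porbits s :\ X0); last first.
      by rewrite (negbTE (contra (subsetP YP X) XP)) (negbTE (contra (subsetP YP' X) XP)).
    have XPs : X \in porbits s by move: XP; rewrite inE => /andP[].
    have := congr1 (os^~ X) E; rewrite /h /= !os_xor (osZ _ _ gZ) // (osZ _ _ gZ') //=.
    by rewrite (GP _ YP).2 // (GP _ YP').2.
  rewrite -YE in E *; congr pair; apply/ffunP => d.
  by have := congr1 (fun h : {ffun D -> bool} => h d) E; rewrite !ffunE => /addIb.
(* A set and its complement have the same cut; excluding [v0] keeps one of the two. *)
pose v0 := tail d0; pose CC := [set cutfun (fun v => v \in W) | W : {set V} in powerset [set~ v0]].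
have cardC : #|CC| = (2 ^ #|V|.-1)%N.
  rewrite card_in_imset ?card_powerset ?cardsC1 // => W W'.
  rewrite !powersetE => /subsetP Wv /subsetP Wv' E.
  have v0W (W1 : {set V}) : {subset W1 <= [set~ v0]} -> (v0 \in W1) = false.
    by move=> sW; apply/negP => /sW; rewrite !inE eqxx.
  apply/setP => v; pose chi u := (u \in W) (+) (u \in W').
  have /(_ v v0) : forall u w, chi u = chi w.
    apply: map_conn => d; have := congr1 (fun h : {ffun D -> bool} => h d) E.
    rewrite !ffunE /chi /=.
    by case: (_ \in W); case: (_ \in W); case: (_ \in W'); case: (_ \in W').
  by rewrite /chi !v0W //=; case: (v \in W); case: (v \in W').
have CZ : CC \subset Z.
  apply/subsetP => _ /imsetP[W _ ->]; rewrite inE; apply/andP; split.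
    by apply/SymP => d; rewrite !ffunE alK addbC.
  apply/'forall_implyP => X XP; rewrite /os.
  rewrite (eq_bigr (fun d => ((d \in X) && (tail d \in W)) (+)
      ((d \in X) && (tail (s d) \in W)))); last first.
    by move=> d _; rewrite ffunE tail_s; case: (d \in X).
  by rewrite big_split /= (@sum_invariant_s (fun d => d \in X) (fun d => tail d \in W)) ?addbb //;
    exact: porb_inv.
have leZC : (#|Z| <= #|CC|)%N.
  have V0 : (0 < #|V|)%N by apply/card_gt0P; exists v0.
  have F0 : (0 < #|porbits s|)%N by apply/card_gt0P; exists X0.
  have SymB : (#|Sym| <= 2 ^ (#|V|.-1 + #|porbits s|.-1))%N.
    rewrite -leq_sqr -!mulnn (leq_trans card_Sym) // -expnD leq_exp2l //; lia.
  rewrite cardC -(leq_pmul2r (_ : 0 < 2 ^ #|porbits s|.-1)%N) ?expn_gt0 //.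
  by rewrite -expnD; exact: leq_trans SymB.
have : [ffun d => f d] \in Z.
  rewrite inE; apply/andP; split; first by apply/SymP => d; rewrite !ffunE.
  apply/'forall_implyP => X XP; rewrite /os.
  under eq_bigr => d _ do rewrite ffunE.
  by rewrite (fg (fun d => d \in X)) // => d; exact: porb_inv.
have /eqP <- : CC == Z by rewrite eqEcard CZ.
case/imsetP => W _ E; exists (fun v => v \in W) => d.
by have := congr1 (fun h : {ffun D -> bool} => h d) E; rewrite !ffunE.
Qed.

End Duality.

(** * The subdivided dual network of a map *)

Lemma leq_card_imset_ker (D T1 T2 : finType) (F : D -> T1) (G : D -> T2) :
  (forall d d', G d = G d' -> F d = F d') -> (#|F @: D| <= #|G @: D|)%N.
Proof.
have Sinj : injective (@Some T1) by move=> x y [].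
move=> GF; rewrite -(card_imset _ Sinj).
rewrite (_ : Some @: _ = (fun y => omap F [pick d | G d == y]) @: (G @: D)).
  exact: leq_imset_card.
have pickE d : omap F [pick d' | G d' == G d] = Some (F d).
  by case: pickP => [d' /eqP /GF /= ->//|/(_ d)]; rewrite eqxx.
apply/setP => o; apply/imsetP/imsetP => -[_ /imsetP[d _ ->] ->].
  by exists (G d); rewrite ?imset_f ?pickE.
by exists (F d); rewrite ?imset_f ?pickE.
Qed.

Lemma eq_card_imset_ker (D T1 T2 : finType) (F : D -> T1) (G : D -> T2) :
  (forall d d', G d = G d' <-> F d = F d') -> #|F @: D| = #|G @: D|.
Proof.
by move=> GF; apply/eqP; rewrite eqn_leq !leq_card_imset_ker // => d d' /GF.
Qed.

Lemma porbit_rot (D : finType) (al f : {perm D}) x y :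
  (al x \in porbit (f * al)%g (al y)) = (x \in porbit (al * f)%g y).
Proof.
have E i : ((f * al) ^+ i)%g (al y) = al (((al * f) ^+ i)%g y).
  elim: i => [|i IH]; first by rewrite !perm1.
  by rewrite !expgSr !permM IH.
apply/porbitP/porbitP => -[i]; first by rewrite E => /perm_inj->; exists i.
by move=> ->; exists i; rewrite E.
Qed.

Section Dual.
Context {R : realType} {k : nat} {D : finType}.
Variables (al f : {perm D}) (e : 'I_k -> D) (wd : D -> R).

Definition face_of := {X : {set D} | X \in porbits f}.

Lemma porbit_in_porbits d : porbit f d \in porbits f.
Proof. exact: imset_f. Qed.

Definition pob (d : D) : face_of := exist _ (porbit f d) (porbit_in_porbits d).

Definition dual_vert := (D + face_of)%type.

Definition dual_adj : rel dual_vert := fun x y =>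
  match x, y with
  | inl d, inl d' => d' == al d
  | inl d, inr X | inr X, inl d => d \in val X
  | inr _, inr _ => false
  end.

(* Each dual edge is subdivided twice, so that loops and parallel edges of the
   dual do not leave the class of simple graphs; the middle part carries the weight. *)
Definition dual_net : network R k :=
  @Network R k dual_vert dual_adj
    (fun x y => match x, y with inl d, inl _ => wd d | _, _ => 0 end)
    (fun i => inr (pob (e i))).

Hypothesis alK : forall d, al (al d) = d.
Hypothesis al_neq : forall d, al d != d.

Lemma pobP d (X : face_of) : (d \in val X) = (pob d == X).
Proof.
case: X => X XP; rewrite -val_eqE /=; case/imsetP: (XP) => d' _ ->.
by rewrite eq_porbit_mem.
Qed.

Lemma pob_ex (X : face_of) : exists d, pob d = X.
Proof.
case: X => X XP; case/imsetP: (XP) => d _ E; exists d.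
by apply: val_inj.
Qed.

Lemma pob_perm d : pob (f d) = pob d.
Proof. by apply: val_inj => /=; apply/eqP; rewrite eq_porbit_mem porbit_step. Qed.

Lemma pob_eq d d' : (pob d == pob d') = (d \in porbit f d').
Proof. by rewrite -val_eqE /= eq_porbit_mem. Qed.

Lemma dual_adj_sym : symmetric dual_adj.
Proof.
by case=> [d|X] [d'|X'] //=; rewrite eq_sym (can2_eq alK alK).
Qed.

Lemma dual_adj_irr : irreflexive dual_adj.
Proof. by case=> [d|X] //=; rewrite eq_sym (negbTE (al_neq d)). Qed.

Hypothesis wd_ge0 : forall d, 0 <= wd d.
Hypothesis wd_al : forall d, wd (al d) = wd d.
Hypothesis e_dist : forall i j, e i \in porbit f (e j) -> i = j.
Hypothesis conn : forall g : pred D,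
  (forall d, g (f d) = g d) -> (forall d, g (al d) = g d) -> forall d d', g d = g d'.

Lemma dual_net_network : is_network dual_net.
Proof.
split.
- exact: dual_adj_sym.
- exact: dual_adj_irr.
- by case=> [d|X] [d'|X'] //= /eqP->; rewrite wd_al.
- by move=> i j [/setP/(_ (e i))]; rewrite porbit_id => /esym/e_dist.
have cs := sym_connect_sym dual_adj_sym.
have toface d : connect dual_adj (inl d) (inr (pob d)).
  by apply: connect1; rewrite /= porbit_id.
have inls d d' : connect dual_adj (inl d) (inl d').
  rewrite (@conn (fun d' => connect dual_adj (inl d) (inl d')) _ _ d' d) ?connect0 //.
    move=> d1; apply: (same_connect_r cs); apply: connect_trans (toface _) _.
    by rewrite pob_perm cs.
  by move=> d1; apply: (same_connect_r cs); apply: connect1; rewrite /= alK.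
have toinl (x : dual_vert) : exists d, connect dual_adj (inl d) x.
  case: x => [d|X]; first by exists d; exact: connect0.
  by have [d <-] := pob_ex X; exists d; exact: toface.
move=> x y; have [d dx] := toinl x; have [d' dy] := toinl y.
apply: connect_trans (connect_trans (inls d d') dy).
by rewrite /= cs.
Qed.

(** * A spherical embedding of the dual network *)

Definition dual_rot (p : dual_vert * dual_vert) : dual_vert * dual_vert :=
  if dual_adj p.1 p.2 then
    match p with
    | (inl d, inr _) => (inl d, inl (al d))
    | (inl d, inl _) => (inl d, inr (pob d))
    | (inr X, inl d) => (inr X, inl (f d))
    | _ => p
    end
  else p.

Lemma dual_rot_adj p : dual_adj (dual_rot p).1 (dual_rot p).2 = dual_adj p.1 p.2.
Proof.
rewrite /dual_rot; case E: (dual_adj p.1 p.2) => //.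
case: p E => -[d|X] [d'|X'] //= E; rewrite ?porbit_id ?eqxx //.
by rewrite pobP pob_perm -pobP.
Qed.

Lemma dual_rot_inj : injective dual_rot.
Proof.
move=> p q E; have := dual_rot_adj p; rewrite E dual_rot_adj => /esym.
move: E; rewrite /dual_rot; case: ifP; case: ifP => //.
case: p q => [[d1|X1] [d2|X2]] [[d3|X3] [d4|X4]] //=.
- by move=> /eqP-> /eqP-> [->].
- by rewrite !pobP => /eqP<- /eqP<- [->].
- by move=> _ _ [->] /perm_inj->.
Qed.

Let phi := @face_succ R k dual_net dual_rot.

Lemma dual_face_inj : injective phi.
Proof. by move=> [x y] [x' y'] /dual_rot_inj[-> ->]. Qed.

Let gam (d : D) : dual_vert * dual_vert := (inl d, inr (pob d)).

(** A face of the dual uses three darts for each dart of a cycle of [f * al]. Up to conjugation by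
    [al] these cycles are the vertices of the map. *)
Lemma dual_face3 d : iter 3 phi (gam d) = gam ((f * al)%g d).
Proof.
rewrite /= /phi /face_succ /= /dual_rot /= porbit_id /=.
rewrite (_ : f d \in porbit f d) /=; last exact: porbit_step.
by rewrite alK eqxx permM.
Qed.

Lemma dual_face2 d : iter 2 phi (inr (pob d), inl d) = gam (al d).
Proof.
rewrite /= /phi /face_succ /= /dual_rot /= porbit_id /=.
by rewrite alK eqxx.
Qed.

(** Names a dart whose [gam] lies on the face of [p]. The default [d0] is returned only for pairs of
    faces, which are not edges. *)
Let theta (p : dual_vert * dual_vert) (d0 : D) : D :=
  match p with
  | (inl d, inr _) => d
  | (inr _, inl d) => al d
  | (inl _, inl d) => d
  | _ => d0
  end.

Let theta_gam p d0 : dual_adj p.1 p.2 -> fconnect phi p (gam (theta p d0)).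
Proof.
case: p => -[d|X] [d'|X'] //=.
- move=> /eqP->; have <- : phi (inl d, inl (al d)) = gam (al d); last exact: fconnect1.
  by rewrite /phi /face_succ /dual_rot /= alK eqxx.
- by rewrite pobP => /eqP<-; exact: connect0.
- rewrite pobP => /eqP<-; rewrite -dual_face2; exact: fconnect_iter.
Qed.

Let phi_adj p : dual_adj (phi p).1 (phi p).2 = dual_adj p.1 p.2.
Proof. by rewrite dual_rot_adj dual_adj_sym. Qed.

Let theta_phi p d0 : dual_adj p.1 p.2 ->
  theta (phi p) d0 \in porbit (f * al)%g (theta p d0).
Proof.
case: p => -[d|X] [d'|X'] //= E; rewrite /phi /face_succ /dual_rot /=.
- by rewrite -(can2_eq alK alK) eq_sym E /= porbit_id.
- by rewrite E /= -permM porbit_step.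
- by rewrite E /= porbit_id.
Qed.

Let fconnect_gam d d' : fconnect phi (gam d) (gam d') = (d' \in porbit (f * al)%g d).
Proof.
apply/idP/idP => [|/porbitP[i ->]].
  pose P p := dual_adj p.1 p.2 /\ theta p d \in porbit (f * al)%g d.
  have Pit i : P (iter i phi (gam d)).
    elim: i => [|i [IH1 IH2]]; first by split; rewrite /= porbit_id.
    split; first by rewrite iterS phi_adj.
    by rewrite iterS; exact: porbit_trans (theta_phi d IH1) IH2.
  by move=> /iter_findex E; have [] := Pit (findex phi (gam d) (gam d')); rewrite E.
elim: i => [|i IH]; first by rewrite perm1 connect0.
by rewrite expgSr permM -dual_face3; exact: connect_trans IH (fconnect_iter _ _ _).
Qed.

Lemma card_dual_darts : #|darts dual_net| = (3 * #|D|)%N.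
Proof.
pose h (t : D + D + D) : dual_vert * dual_vert := match t with
  | inl (inl d) => (inl d, inr (pob d))
  | inl (inr d) => (inr (pob d), inl d)
  | inr d => (inl d, inl (al d)) end.
pose h' (p : dual_vert * dual_vert) : option (D + D + D) := match p with
  | (inl d, inr _) => Some (inl (inl d))
  | (inr _, inl d) => Some (inl (inr d))
  | (inl d, inl _) => Some (inr d)
  | _ => None end.
have h_inj : injective h by apply: (@pcan_inj _ _ h h') => -[[d|d]|d].
have -> : darts dual_net = h @: setT.
  apply/setP => -[x y]; rewrite inE /=; apply/idP/imsetP => [|[t _ E]].
    case: x y => [d|X] [d'|X'] //=.
    + by move=> /eqP->; exists (inr d).
    + by rewrite pobP => /eqP<-; exists (inl (inl d)).
    + by rewrite pobP => /eqP<-; exists (inl (inr d')).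
  by case: t E => [[d|d]|d] [-> ->] /=; rewrite ?porbit_id ?eqxx.
by rewrite card_imset // cardsT !card_sum; lia.
Qed.

Lemma card_dual_faces : #|faces dual_net dual_rot| = #|porbits (al * f)%g|.
Proof.
pose face p := [set p' | fconnect phi p p'].
have face_eq p q : fconnect phi p q -> face p = face q.
  move=> pq; apply/setP => p'; rewrite !inE.
  exact: (same_connect (fconnect_sym dual_face_inj) pq).
have faceP d d' : face (gam d) = face (gam d') <-> d' \in porbit (f * al)%g d.
  rewrite -fconnect_gam; split=> [/setP/(_ (gam d'))|]; last exact: face_eq.
  by rewrite !inE connect0.
transitivity #|(fun d => face (gam d)) @: D|.
  congr #|pred_of_set _|; apply/setP => F; apply/imsetP/imsetP => -[].
    move=> p; rewrite inE => padj ->.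
    have d0 : D by case: p padj => -[d|X] [d'|X'].
    by exists (theta p d0) => //; apply: face_eq; exact: theta_gam.
  by move=> d _ ->; exists (gam d) => //; rewrite inE /= porbit_id.
transitivity #|porbit (f * al)%g @: D|.
  apply: eq_card_imset_ker => d d'; rewrite faceP; split=> [->|]; first exact: porbit_id.
  by rewrite -eq_porbit_mem => /eqP->.
transitivity #|(fun d => porbit (f * al)%g (al d)) @: D|.
  congr #|pred_of_set _|; apply/setP => X; apply/imsetP/imsetP => -[d _ ->].
    by exists (al d); rewrite ?alK.
  by exists (al d).
apply: eq_card_imset_ker => d d'; split=> /eqP h; apply/eqP; move: h;
  by rewrite !eq_porbit_mem porbit_rot.
Qed.

Lemma card_dual_vert : #|{: dual_vert}| = (#|D| + #|porbits f|)%N.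
Proof. by rewrite card_sum card_sig; congr (_ + _)%N; apply: eq_card. Qed.

Lemma dual_rotation_system : rotation_system dual_net dual_rot.
Proof.
split.
- move=> p; rewrite !inE /= dual_rot_adj => padj; split=> //.
  by rewrite /dual_rot padj; case: p padj => -[d|X] [d'|X'].
- by move=> p q _ _; exact: dual_rot_inj.
move=> [x y] [x' y']; rewrite !inE /= => xy xy' xx'; rewrite -{x'}xx' in xy' *.
case: x xy xy' => [d|X].
  have step1 : dual_rot (inl d, inl (al d)) = (inl d, inr (pob d)).
    by rewrite /dual_rot /= eqxx.
  have step2 : dual_rot (inl d, inr (pob d)) = (inl d, inl (al d)).
    by rewrite /dual_rot /= porbit_id.
  case: y y' => [d1|X1] [d2|X2] /=.
  + by move=> /eqP-> /eqP->; exact: connect0.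
  + by rewrite pobP => /eqP-> /eqP<-; rewrite -step1; exact: fconnect1.
  + by rewrite pobP => /eqP<- /eqP->; rewrite -step2; exact: fconnect1.
  + by rewrite !pobP => /eqP<- /eqP<-; exact: connect0.
case: y y' => [d1|X1] [d2|X2] //=; rewrite !pobP => /eqP<-.
rewrite pob_eq => /porbitP[i ->].
elim: i => [|i IH]; first by rewrite perm1 connect0.
apply: connect_trans IH _; rewrite expgSr permM.
have <- : dual_rot (inr (pob d1), inl ((f ^+ i)%g d1)) =
   (inr (pob d1), inl (f ((f ^+ i)%g d1))); last exact: fconnect1.
by rewrite /dual_rot /= mem_porbit.
Qed.

Hypothesis euler : (2 * #|porbits f| + 2 * #|porbits (al * f)%g| = #|D| + 4)%N.
Hypothesis e_face : forall i j, e i \in porbit (al * f)%g (e j).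

(** With [|D|] subdivision vertices and [3 |D|] darts, the formula for the network reduces to
    [euler]. The common face of the terminals is the one given by the cycle in [e_face]. *)
Lemma dual_net_planar (i0 : 'I_k) : planar_terminals_one_face dual_net.
Proof.
exists dual_rot; split; first exact: dual_rotation_system.
  by rewrite /spherical card_dual_faces card_dual_darts card_dual_vert; lia.
pose q i : dual_vert * dual_vert := (inr (pob (e i)), inl (e i)).
have q_dart i : q i \in darts dual_net by rewrite inE /= porbit_id.
exists (q i0) => // i; exists (q i) => //; split=> //.
have q_gam j : fconnect phi (q j) (gam (al (e j))).
  by rewrite -dual_face2; exact: fconnect_iter.
apply: connect_trans (q_gam i0) _.
rewrite (fconnect_sym dual_face_inj); apply: connect_trans (q_gam i) _.
by rewrite fconnect_gam porbit_rot.
Qed.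

End Dual.

(** * Chains of the dual network *)

Section DualChains.
Context {R : realType} {k : nat} {V D : finType}.
Variables (tail : D -> V) (al s sg : {perm D}) (e : 'I_k -> D) (wd : D -> R).
Variable nxt : 'I_k -> 'I_k.
Hypothesis alK : forall d, al (al d) = d.
Hypothesis al_neq : forall d, al d != d.
Hypothesis tail_s : forall d, tail (s d) = tail (al d).
Hypothesis tail_star : forall d d', tail d = tail d' -> d' \in porbit (al * s)%g d.
Hypothesis map_conn : forall chi : pred V,
  (forall d, chi (tail d) = chi (tail (al d))) -> forall u v, chi u = chi v.
Hypothesis euler : (2 * #|V| + 2 * #|porbits s| = #|D| + 4)%N.
Hypothesis sg_on : perm_on (e @: setT) sg.
Hypothesis sg_nxt : forall i, sg (e (nxt i)) = e i.
Hypothesis e_dist : forall i j, e i \in porbit (s * sg)%g (e j) -> i = j.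
Hypothesis e_orb : forall i j, e i \in porbit s (e j).

Let f := (s * sg)%g.
Notation N := (@dual_net R k D al f e wd).

Lemma e_inj : injective e.
Proof. by move=> i j E; apply: e_dist; rewrite E porbit_id. Qed.

Lemma nxt_inj : injective nxt.
Proof. by move=> i j E; apply: e_inj; rewrite -(sg_nxt i) E sg_nxt. Qed.

(** Where [f] closes an arc by returning to its start, [s] goes on to the start of the next arc. *)
Lemma s_nxt d j : f d = e j -> s d = e (nxt j).
Proof. by rewrite permM -sg_nxt => /perm_inj. Qed.

Lemma s_out d : f d \notin e @: setT -> s d = f d.
Proof. by rewrite permM perm_closed // => /(out_perm sg_on). Qed.

Lemma invariant_f (g : pred D) : (forall d, g (s d) = g d) -> forall d, g (f d) = g d.
Proof.
move=> gs d; have [/imsetP[j _ fd]|/s_out<-//] := boolP (f d \in e @: setT).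
have -> : g (f d) = g (e (nxt j)) by rewrite fd; apply: porbit_fixed (e_orb _ _).
by rewrite -(s_nxt fd).
Qed.

(* That is, [nxt] permutes the terminals in a single cycle. *)
Lemma nxt_invariant (h : pred 'I_k) : (forall i, h (nxt i) = h i) -> forall i j, h i = h j.
Proof.
move=> hn; pose g d := [exists i, (d \in porbit f (e i)) && h i].
have ge i : g (e i) = h i.
  apply/existsP/idP => [[j /andP[/e_dist-> //]]|hi].
  by exists i; rewrite porbit_id.
have gf d : g (f d) = g d by apply: eq_existsb => i; rewrite mem_porbit_perm.
have gs d : g (s d) = g d.
  rewrite -[RHS]gf; have [/imsetP[j _ fd]|/s_out->//] := boolP (f d \in e @: setT).
  by rewrite (s_nxt fd) fd !ge hn.
by move=> i j; rewrite -!ge; apply: porbit_fixed (e_orb _ _).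
Qed.

(** Arc [i] runs from terminal [i] to terminal [nxt i], so this is the parity of the cut edges met
    along it. *)
Definition cut_pattern (chi : pred V) : pred 'I_k :=
  fun i => chi (tail (e i)) (+) chi (tail (e (nxt i))).

Definition dual_chain (g : pred D) : rel (nv N) := fun x y =>
  match x, y with
  | inl d, inl d' => (d' == al d) && g d
  | inl d, inr X | inr X, inl d => (d \in val X) && g d
  | inr _, inr _ => false
  end.

Lemma dual_chain_chain (g : pred D) : (forall d, g (al d) = g d) -> is_chain (dual_chain g).
Proof.
move=> ga; split; last by case=> [d|X] [d'|X'] //= /andP[].
case=> [d|X] [d'|X'] //=; rewrite eq_sym (can2_eq alK alK).
by case: eqP => // ->; rewrite ga.
Qed.

Lemma bd_dual_inl (z : rel (nv N)) d : subrel z (nadj N) ->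
  bd z (inl d) = z (inl d) (inl (al d)) (+) z (inl d) (inr (pob f d)).
Proof.
move=> zn; rewrite /bd big_sumType /=; congr (_ (+) _).
  rewrite (bigD1 (al d)) //= big1 ?addbF // => d' /negbTE nd.
  by apply/negP => /zn /=; rewrite nd.
rewrite (bigD1 (pob f d)) //= big1 ?addbF // => X nX.
by apply/negP => /zn /=; rewrite pobP eq_sym (negbTE nX).
Qed.

Lemma bd_dual_inr (z : rel (nv N)) X : subrel z (nadj N) ->
  bd z (inr X) = \big[addb/false]_(d | pob f d == X) z (inr X) (inl d).
Proof.
move=> zn; rewrite /bd big_sumType /= [X in _ (+) X]big1 ?addbF => [|X' _].
  rewrite [RHS]big_mkcond; apply: eq_bigr => d _; rewrite -pobP.
  by case: ifP => // nd; apply/negP => /zn /=; rewrite nd.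
by apply/negP => /zn.
Qed.

Lemma on_terms_inl tau d : on_terms (N := N) tau (inl d) = false.
Proof. by apply/existsP => -[i /andP[/eqP]]. Qed.

Lemma on_terms_inr tau X : on_terms (N := N) tau (inr X) =
  \big[addb/false]_i ((pob f (e i) == X) && tau i).
Proof.
apply/existsP/idP => [[i /andP[/eqP[E] ti]]|].
  rewrite (bigD1 i) //= E eqxx ti big1 // => j ji.
  by rewrite -E pob_eq; apply/negP => /andP[/e_dist ij]; rewrite ij eqxx in ji.
apply: contraPP => nex; rewrite big1 // => i _; apply/negP => /andP[/eqP E ti].
by apply: nex; exists i; rewrite ti andbT; apply/eqP; congr inr.
Qed.

Lemma on_terms_pob tau i : on_terms (N := N) tau (inr (pob f (e i))) = tau i.
Proof.
rewrite on_terms_inr -[RHS](xor_pred1 i tau); apply: eq_bigr => j _.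
congr (_ && _); rewrite pob_eq; apply/idP/eqP => [/e_dist//|->].
exact: porbit_id.
Qed.

(** Around a cycle of [f] the differences of [chi] telescope, except where [f] and [s] disagree.
    There the jump back to the start of arc [i] leaves the difference between terminals [i] and
    [nxt i]. *)
Lemma bd_cut_chain (chi : pred V) :
  bd (dual_chain (cutfun tail al chi)) =1 on_terms (cut_pattern chi).
Proof.
have gal d : cutfun tail al chi (al d) = cutfun tail al chi d.
  by rewrite !ffunE alK addbC.
have [_ zn] := dual_chain_chain gal.
case=> [d|X].
  rewrite bd_dual_inl // on_terms_inl /= eqxx porbit_id /=.
  exact: addbb.
rewrite bd_dual_inr // on_terms_inr /=.
pose inX d := pob f d == X.
transitivity (\big[addb/false]_d ((inX d && chi (tail d)) (+)
   (inX d && chi (tail (sg^-1%g (f d)))))).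
  rewrite big_mkcond; apply: eq_bigr => d _; rewrite /inX pobP ffunE permM permK tail_s.
  by case: (pob f d == X).
rewrite big_split /=.
have -> : \big[addb/false]_d (inX d && chi (tail (sg^-1%g (f d)))) =
    \big[addb/false]_d (inX d && chi (tail (sg^-1%g d))).
  rewrite [RHS](reindex_inj (@perm_inj _ f)) /=.
  by apply: eq_bigr => d _; rewrite /inX pob_perm.
rewrite -big_split /= (bigID (mem (e @: setT))) /= [X in _ (+) X]big1 ?addbF; last first.
  move=> d nd; have -> : sg^-1%g d = d by apply: (out_perm _ nd); rewrite perm_onV.
  exact: addbb.
rewrite big_imset /=; last by move=> i j _ _; exact: e_inj.
apply: eq_big => [i|i _]; first by rewrite inE.
have -> : sg^-1%g (e i) = e (nxt i) by rewrite -{1}(sg_nxt i) permK.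
by rewrite /inX /cut_pattern; case: (_ == X).
Qed.

Lemma wt_dual_chain (g : pred D) : wt (dual_chain g) = \sum_(d | g d) wd d.
Proof.
rewrite /wt big_sumType /= [X in _ + X]big1 ?addr0 => [|X _]; last first.
  by rewrite big1 // => -[].
rewrite [RHS]big_mkcond; apply: eq_bigr => d _.
rewrite big_sumType /= [X in _ + X]big1 ?addr0 //.
case: ifP => gd; last by rewrite big_pred0 // => d'; rewrite andbF.
by rewrite (big_pred1 (al d)) // => d'; rewrite andbT.
Qed.

(** Subdivision vertices are not terminals, so [z] contains all three parts of a dual edge or none
    and amounts to an edge set [g]. This [g] is even on every face of the uncut map, hence a cut. *)
Lemma chain_of_dual (z : rel (nv N)) (tau : pred 'I_k) (i0 : 'I_k) :
  is_chain z -> bd z =1 on_terms tau -> \big[addb/false]_i tau i = false ->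
  exists chi : pred V, z =2 dual_chain (cutfun tail al chi) /\ tau =1 cut_pattern chi.
Proof.
move=> [zs zn] zb tau0; pose g d := z (inl d) (inr (pob f d)).
have gE d : z (inl d) (inl (al d)) = g d.
  have := zb (inl d); rewrite bd_dual_inl // on_terms_inl /g.
  by case: (z _ _); case: (z _ _).
have gal d : g (al d) = g d by rewrite -gE zs alK gE.
have zE : z =2 dual_chain g.
  case=> [d|X] [d'|X'] /=.
  - case: eqP => [->|nd]; first exact: gE.
    by apply/negP => /zn /= /eqP.
  - rewrite pobP; case: eqP => [<-//|nd].
    by apply/negP => /zn /=; rewrite pobP => /eqP.
  - rewrite zs pobP; case: eqP => [<-//|nd].
    by apply/negP => /zn /=; rewrite pobP => /eqP.
  - by apply/negP => /zn.
have [chi chiE] : exists chi : pred V, forall d, g d = chi (tail d) (+) chi (tail (al d)).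
  apply: (cutcycle_duality alK al_neq tail_s tail_star map_conn (e i0) euler gal).
  (* An [s]-invariant [h] has the same value on all arcs, so the sum reduces to the total parity of
     [tau], which is even. *)
  move=> h hs; have hf := invariant_f hs.
  rewrite (partition_big (pob f) xpredT) //=.
  pose H X := [exists d, (pob f d == X) && h d].
  have HE d : H (pob f d) = h d.
    apply/existsP/idP => [[d' /andP[]]|hd]; last by exists d; rewrite eqxx.
    by rewrite pob_eq => /(porbit_fixed hf)->.
  transitivity (\big[addb/false]_X \big[addb/false]_i ((pob f (e i) == X) && (h (e i) && tau i))).
    apply: eq_bigr => X _.
    transitivity (H X && bd z (inr X)).
      rewrite bd_dual_inr // big_distrr /=; apply: eq_bigr => d /eqP <-.
      by rewrite HE zs.
    rewrite zb on_terms_inr big_distrr /=; apply: eq_bigr => i _.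
    by case: eqP => [<-|]; rewrite ?HE ?andbF.
  rewrite exchange_big /=.
  transitivity (\big[addb/false]_i (h (e i0) && tau i)).
    apply: eq_bigr => i _.
    rewrite (eq_bigr (fun X => (X == pob f (e i)) && (h (e i) && tau i))).
      by rewrite xor_pred1 (porbit_fixed hs (e_orb i i0)).
    by move=> X _; rewrite eq_sym.
  by rewrite -big_distrr /= tau0 andbF.
exists chi.
have {}zE : z =2 dual_chain (cutfun tail al chi).
  move=> x y; rewrite zE.
  by case: x y => [d|X] [d'|X'] //=; rewrite chiE ffunE.
split=> // i.
rewrite -on_terms_pob -zb -[RHS]on_terms_pob -bd_cut_chain.
by apply: eq_bigr => y _; rewrite zE.
Qed.

End DualChains.

(** * The map of an embedded network *)

Section NetworkMap.
Context {R : realType} {k : nat} (G : network R k).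
Hypothesis hG : is_network G.

Definition dart := {d : nv G * nv G | d \in darts G}.

Definition mk_dart p (h : p \in darts G) : dart := exist (fun p => p \in darts G) p h.

Definition dart_tail (d : dart) : nv G := (val d).1.

Lemma dart_swap_proof (d : dart) : ((val d).2, (val d).1) \in darts G.
Proof. by have := valP d; rewrite !inE nadj_sym. Qed.

Definition dart_swap (d : dart) : dart := mk_dart (dart_swap_proof d).

Lemma dart_swapK : involutive dart_swap.
Proof. by move=> d; apply: val_inj; rewrite /=; case: (val d). Qed.

Definition rev_dart : {perm dart} := perm (inv_inj dart_swapK).

Lemma rev_dartE d : val (rev_dart d) = ((val d).2, (val d).1).
Proof. by rewrite permE. Qed.

Lemma rev_dartK d : rev_dart (rev_dart d) = d.
Proof. by rewrite !permE dart_swapK. Qed.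

Lemma rev_dart_neq d : rev_dart d != d.
Proof.
apply: contraTneq (valP d) => /(congr1 val); rewrite rev_dartE.
by case: (val d) => x y [-> _]; rewrite inE /= nadj_irr.
Qed.

Lemma dart_map_conn (chi : pred (nv G)) :
  (forall d, chi (dart_tail d) = chi (dart_tail (rev_dart d))) -> forall u v, chi u = chi v.
Proof.
move=> h u v; have /connectP[p] := network_connected hG u v.
elim: p u => [|a p IH] u /=; first by move=> _ ->.
case/andP=> ua pp E; rewrite -(IH a pp E).
have ud : (u, a) \in darts G by rewrite inE.
by have := h (mk_dart ud); rewrite /dart_tail rev_dartE.
Qed.

(** Rotation and face successor become permutations of the type of darts; composing [s] with the
    reversal recovers the rotation, whose cycles are the vertices. *)
Lemma planar_map : planar_terminals_one_face G ->
  exists (s : {perm dart}) (e : 'I_k -> dart),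
    [/\ forall d, dart_tail (s d) = dart_tail (rev_dart d),
        forall d d', dart_tail d = dart_tail d' -> d' \in porbit (rev_dart * s)%g d,
        (2 * #|nv G| + 2 * #|porbits s| = #|{: dart}| + 4)%N,
        forall i, dart_tail (e i) = nterm G i &
        forall i j, e i \in porbit s (e j)].
Proof.
case=> rho [[rhoD rho_inj rho_star] sph [d0 d0D term]].
have rD (d : dart) : rho (val d) \in darts G by case: (rhoD _ (valP d)).
pose r0 (d : dart) : dart := mk_dart (rD d).
have r0_inj : injective r0.
  move=> d d' /(congr1 val) /= E; apply: val_inj; apply: rho_inj E; exact: valP.
pose r : {perm dart} := perm r0_inj; pose s : {perm dart} := (rev_dart * r)%g.
have val_r d : val (r d) = rho (val d) by rewrite permE.
have val_s d : val (s d) = face_succ G rho (val d) by rewrite permM val_r rev_dartE.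
have als : (rev_dart * s)%g = r.
  by apply/permP => d; rewrite !permM rev_dartK.
have iter_s n d : val ((s ^+ n)%g d) = iter n (face_succ G rho) (val d).
  by elim: n => [|n IH]; rewrite ?perm1 // expgSr permM val_s IH.
have iter_r n d : val ((r ^+ n)%g d) = iter n rho (val d).
  by elim: n => [|n IH]; rewrite ?perm1 // expgSr permM val_r IH.
have face_s d p : fconnect (face_succ G rho) (val d) p = (p \in val @: porbit s d).
  apply/idP/imsetP => [/iter_findex <-|[d' /porbitP[i ->] ->]].
    by rewrite -iter_s; exists ((s ^+ findex (face_succ G rho) (val d) p)%g d);
      rewrite ?mem_porbit.
  by rewrite iter_s fconnect_iter.
have /choice[e eP] i : exists d : dart, val d \in val @: porbit s (mk_dart d0D) /\
    dart_tail d = nterm G i.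
  have [d dD [d0d dt]] := term i; exists (mk_dart dD); split=> //.
  by rewrite -face_s.
have e_orb0 i : e i \in porbit s (mk_dart d0D).
  by have [/imsetP[d dp /val_inj->]] := eP i.
exists s, e; split.
- move=> d; rewrite /dart_tail val_s rev_dartE /face_succ.
  by have := valP (rev_dart d); rewrite rev_dartE => /rhoD[].
- move=> d d' tt; rewrite als.
  have /iter_findex := rho_star _ _ (valP d) (valP d') tt.
  by rewrite -iter_r => /val_inj <-; rewrite mem_porbit.
- move: sph; rewrite /spherical => E.
  rewrite card_sig (eq_card (B := mem (darts G))) // -E; congr (_ + 2 * _)%N.
  rewrite -(card_imset (mem (porbits s)) (imset_inj val_inj)).
  congr #|pred_of_set _|; apply/setP => F; apply/imsetP/imsetP => -[].
    move=> _ /imsetP[d _ ->] ->; exists (val d); first exact: valP.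
    by apply/setP => p; rewrite inE face_s.
  move=> d dD ->; exists (porbit s (mk_dart dD)); first exact: imset_f.
  by apply/setP => p; rewrite inE -face_s.
- by move=> i; case: (eP i).
- by move=> i j; apply: porbit_trans (e_orb0 i) _; rewrite porbit_sym.
Qed.

End NetworkMap.

(** * Counting even chains *)

Section EvenChains.
Context {R : realType} {k : nat} (M : network R k).
Hypothesis hM : is_network M.

Lemma even_neighbor (Z : rel (nv M)) u v : bd Z u = false -> Z u v ->
  exists2 v', v' != v & Z u v'.
Proof.
move=> Zb Zuv; apply: contrapT => nex; move: Zb.
rewrite /bd (bigD1 v) //= Zuv big1 // => v' nv'.
by apply: contra_notF nex => Zuv'; exists v'.
Qed.

(** Besides [u v] there is a second edge at [u] and a second edge at [v], and these differ. Six
    ordered pairs are three edges. *)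
Lemma even_chain_card (Z : rel (nv M)) u v : is_chain Z -> bd Z =1 xpred0 -> Z u v ->
  (6 <= #|[set p : nv M * nv M | Z p.1 p.2]|)%N.
Proof.
move=> [Zs Zn] Zb Zuv; have Zi := chain_irr hM Zn.
have neq x y : Z x y -> x != y by apply: contraTneq => ->; rewrite Zi.
have [v' nv'v Zuv'] := even_neighbor (Zb u) Zuv.
have Zvu : Z v u by rewrite Zs.
have [u' nu'u Zvu'] := even_neighbor (Zb v) Zvu.
have nuv := neq _ _ Zuv; have nuv' := neq _ _ Zuv'; have nvu' := neq _ _ Zvu'.
pose l := [:: (u, v); (v, u); (u, v'); (v', u); (v, u'); (u', v)].
have ul : uniq l.
  rewrite /= !inE !xpair_eqE !eqxx /= ?andbT ?orbF.
  rewrite [v == u]eq_sym [v' == u]eq_sym [u' == v]eq_sym [v == v']eq_sym [u == u']eq_sym.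
  rewrite (negbTE nuv) (negbTE nuv') (negbTE nvu') (negbTE nv'v) (negbTE nu'u) /=.
  by rewrite ?andbF ?orbF.
rewrite -[6%N]/(size l) -(card_uniqP ul); apply: subset_leq_card; apply/subsetP => p.
by rewrite !inE => /or4P[|||/or3P[]] /eqP->; rewrite //= Zs.
Qed.

(** Chains with equal boundary differ by an even chain, so a chain is determined by its boundary and
    an element of [T]. Since every edge set is a chain, this bounds the number of edges. *)
Lemma card_adj_chains (T : finType) m (Phi : T -> rel (nv M)) :
  (forall Z : rel (nv M), is_chain Z -> bd Z =1 xpred0 -> exists t, Z =2 Phi t) ->
  #|T| = (2 ^ m)%N ->
  (#|[set p | nadj M p.1 p.2]| <= 2 * (#|nv M| + m))%N.
Proof.
move=> PhiP cT; pose FF := {ffun nv M * nv M -> bool}.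
pose rl (g : FF) : rel (nv M) := fun x y => g (x, y).
pose SC := [set g : FF | `[< is_chain (rl g) >]].
pose xorg (g h : FF) : FF := [ffun p => g p (+) h p].
have xorgP g h : g \in SC -> h \in SC -> xorg g h \in SC.
  rewrite !inE => /asboolP[gs gn] /asboolP[hs hn]; apply/asboolP; split.
    by move=> x y; rewrite /rl !ffunE -!/(rl _ _ _) gs hs.
  move=> x y; rewrite /rl ffunE -!/(rl _ _ _) => h'; apply: (addc_sub gn hn).
  exact: h'.
have bd_xorg g h x : bd (rl (xorg g h)) x = bd (rl g) x (+) bd (rl h) x.
  by rewrite -bd_addc; apply: eq_bigr => y _; rewrite /rl ffunE.
have cardSC : (#|SC| <= 2 ^ #|nv M| * 2 ^ m)%N.
  have /choice[ch chP] (Y : {set nv M}) : exists g : FF,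
      (exists g', g' \in SC /\ [set x | bd (rl g') x] = Y) ->
      g \in SC /\ [set x | bd (rl g) x] = Y.
    have [[g' h]|nex] := pselect (exists g', g' \in SC /\ [set x | bd (rl g') x] = Y).
      by exists g'.
    by exists [ffun=> false].
  pose Psi (p : {set nv M} * T) : FF := xorg [ffun q => Phi p.2 q.1 q.2] (ch p.1).
  have -> : (2 ^ #|nv M| * 2 ^ m)%N = #|{: {set nv M} * T}|.
    have cV : #|{: {set nv M}}| = (2 ^ #|nv M|)%N.
      rewrite -[#|nv M|]cardsT -card_powerset; apply: eq_card => Y.
      by rewrite powersetE subsetT.
    by rewrite card_prod cT cV.
  apply: leq_trans (leq_imset_card Psi _); apply: subset_leq_card; apply/subsetP => g gS.
  have [cS cE] := chP _ (ex_intro _ g (conj gS erefl)).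
  set Y := [set x | bd (rl g) x] in cS cE.
  have gcS := xorgP _ _ gS cS.
  have [||t tE] := PhiP (rl (xorg g (ch Y))).
  - by move: gcS; rewrite inE => /asboolP.
  - move=> x; rewrite bd_xorg; have /setP/(_ x) := cE; rewrite !inE => ->.
    exact: addbb.
  apply/imsetP; exists (Y, t) => //; apply/ffunP => -[x y].
  by rewrite !ffunE /= -tE /rl ffunE addbK.
pose P := [set p | nadj M p.1 p.2]; pose lt (p : nv M * nv M) := (enum_rank p.1 < enum_rank p.2)%N.
pose mix (p : FF * FF) := [set q in P | if lt q then p.1 q else p.2 q].
(* A set of ordered pairs is coded by two chains, one per orientation. *)
have cardP : (2 ^ #|P| <= #|SC| * #|SC|)%N.
  rewrite -card_powerset -cardsX; apply: leq_trans (leq_imset_card mix _).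
  apply: subset_leq_card; apply/subsetP => B; rewrite powersetE => /subsetP BP.
  pose up : FF := [ffun q => (lt q && (q \in B)) || (~~ lt q && ((q.2, q.1) \in B))].
  pose dn : FF := [ffun q => (lt q && ((q.2, q.1) \in B)) || (~~ lt q && (q \in B))].
  have ltS x y : nadj M x y -> lt (y, x) = ~~ lt (x, y).
    move=> xy; rewrite /lt /=; case: ltngtP => // /val_inj/enum_rank_inj E.
    by move: xy; rewrite E nadj_irr.
  have BPr x y : (x, y) \in B -> nadj M x y by move/BP; rewrite inE.
  have symB (g : FF) : (forall x y, g (x, y) -> nadj M x y) ->
      (forall x y, nadj M x y -> g (y, x) = g (x, y)) -> g \in SC.
    move=> gn gs; rewrite inE; apply/asboolP; split=> [x y|]; last by move=> x y; exact: gn.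
    rewrite /rl; apply/idP/idP => h; first by rewrite gs // gn.
    by rewrite gs // gn.
  apply/imsetP; exists (up, dn).
    apply/setXP; split; apply: symB => x y; rewrite !ffunE /=.
    + by case/orP=> /andP[_ /BPr//]; rewrite nadj_sym.
    + by move=> xy; rewrite ltS //; case: (lt _); rewrite /= ?orbF.
    + by case/orP=> /andP[_ /BPr//]; rewrite nadj_sym.
    + by move=> xy; rewrite ltS //; case: (lt _); rewrite /= ?orbF.
  apply/setP => -[x y]; rewrite !inE !ffunE /=.
  case: (boolP (nadj M x y)) => [_|nxy] /=; last by apply/negP => /BPr; rewrite (negbTE nxy).
  by case: (lt _); rewrite /= ?orbF.
rewrite -(leq_exp2l _ _ (ltnSn 1)); apply: (leq_trans cardP).
by rewrite mul2n -addnn [in X in (_ <= X)%N]expnD expnD; exact: leq_mul.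
Qed.

End EvenChains.

(** * Minimum cuts *)

Section Mincut.
Context {R : realType} {k : nat} (G : network R k).
Hypothesis hG : is_network G.

Lemma cutval_ge0 W : 0 <= cutval G W.
Proof.
by apply: sumr_ge0 => x _; apply: sumr_ge0 => y /andP[_]; exact: nw_ge0.
Qed.

Lemma mincut_le S W : cut_feasible G S W -> mincut G S <= cutval G W.
Proof.
move=> fW; apply: ge_inf; last by exists W.
by exists 0 => _ [W' [_ ->]]; exact: cutval_ge0.
Qed.

Lemma le_mincut S x : (forall W, cut_feasible G S W -> x <= cutval G W) -> x <= mincut G S.
Proof.
move=> h; apply: lb_le_inf; last by move=> _ [W [fW ->]]; exact: h.
exists (cutval G (nterm G @: S)), (nterm G @: S); split=> //.
rewrite /cut_feasible (setIidPl _) ?eqxx //; exact/imsetS/subsetT.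
Qed.

Lemma cut_feasibleP (S : {set 'I_k}) (W : {set nv G}) : reflect
  ((forall i, (nterm G i \in W) = (i \in S)) \/ (forall i, (nterm G i \in W) = (i \notin S)))
  (cut_feasible G S W).
Proof.
have key (S' : {set 'I_k}) : reflect (forall i, (nterm G i \in W) = (i \in S'))
    (W :&: (nterm G @: [set: 'I_k]) == nterm G @: S').
  apply: (iffP eqP) => [/setP E i|E].
    have := E (nterm G i); rewrite inE (imset_f _ (in_setT i)) andbT => ->.
    by rewrite mem_imset //; exact: nterm_inj.
  apply/setP => x; rewrite inE; apply/andP/imsetP => [[xW /imsetP[i _ xi]]|[i iS ->]].
    by exists i; rewrite // -E -xi.
  by rewrite E iS imset_f.
apply: (iffP orP) => -[h|h].
- by left; apply/key.
- by right=> i; move/key: h => ->; rewrite inE.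
- by left; apply/key.
- by right; apply/key => i; rewrite h inE.
Qed.

(** The changes along the cycle [nxt] determine the trace of [W] on the terminals up to complement,
    which is the freedom that feasibility allows. *)
Lemma cut_feasible_pattern (S : {set 'I_k}) (W : {set nv G}) (nxt : 'I_k -> 'I_k) :
  (forall h : pred 'I_k, (forall i, h (nxt i) = h i) -> forall i j, h i = h j) ->
  reflect (forall i, (nterm G i \in W) (+) (nterm G (nxt i) \in W) =
                     (i \in S) (+) (nxt i \in S)) (cut_feasible G S W).
Proof.
move=> trans; apply: (iffP (cut_feasibleP S W)) => [[h|h] i|h]; rewrite ?h //.
  by rewrite addNb addbN negbK.
pose g i := (nterm G i \in W) (+) (i \in S).
have gn i : g (nxt i) = g i.
  have := h i; rewrite /g.
  by case: (_ \in W); case: (_ \in W); case: (_ \in S); case: (_ \in S).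
have [[i0]|no] := pselect (inhabited 'I_k); last first.
  by left=> i; case: no; exact: (inhabits i).
have gi i : g i = g i0 by exact: trans.
case E: (g i0); [right|left] => i; have := gi i; rewrite E /g;
  by case: (_ \in W); case: (_ \in S).
Qed.

Lemma cutval_darts (W : {set nv G}) : cutval G W *+ 2 =
  \sum_(d : dart G | (dart_tail d \in W) (+) (dart_tail (rev_dart hG d) \in W))
     nw G (val d).1 (val d).2.
Proof.
have cutE : cutval G W = \sum_(d : dart G | ((val d).1 \in W) && ((val d).2 \notin W))
    nw G (val d).1 (val d).2.
  rewrite -(big_sub_cond (darts G) (fun p => (p.1 \in W) && (p.2 \notin W))
     (fun p => nw G p.1 p.2)) /cutval pair_big_dep /=.
  by apply: eq_bigl => -[x y]; rewrite inE /= andbC andbA andbC; do !bool_congr.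
rewrite mulr2n {1}cutE cutE.
rewrite {2}(reindex_inj (@perm_inj _ (rev_dart hG))) /=.
rewrite [RHS](bigID (fun d => (val d).1 \in W)) /=; congr (_ + _).
  apply: eq_bigl => d; rewrite /dart_tail rev_dartE /=.
  by case: ((val d).1 \in W); case: ((val d).2 \in W).
apply: eq_big => [d|d _]; rewrite /dart_tail !rev_dartE /=.
  by case: ((val d).1 \in W); case: ((val d).2 \in W).
by apply: nw_sym => //; have := valP (rev_dart hG d); rewrite inE rev_dartE.
Qed.

End Mincut.

(** * Contracting edges of a network *)

Section Contract.
Context {R : realType} {k : nat} (G : network R k).
Hypothesis hG : is_network G.
Notation al := (rev_dart hG).
Variables (keep : pred (dart G)) (om : dart G -> R).
Hypothesis keep_al : forall d, keep (al d) = keep d.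
Hypothesis om_ge0 : forall d, 0 <= om d.
Hypothesis om_al : forall d, om (al d) = om d.

Definition contracted : rel (nv G) := fun x y =>
  [exists d : dart G, [&& ~~ keep d, dart_tail d == x & dart_tail (al d) == y]].

Lemma contracted_sym : symmetric contracted.
Proof.
move=> x y; apply/existsP/existsP => -[d /and3P[kd dx dy]]; exists (al d);
  by rewrite keep_al kd rev_dartK dx dy.
Qed.

Lemma contracted_adj x y : contracted x y -> nadj G x y.
Proof.
case/existsP=> d /and3P[_ /eqP <- /eqP <-]; rewrite /dart_tail rev_dartE.
by have := valP d; rewrite inE.
Qed.

Let csym : connect_sym contracted := sym_connect_sym contracted_sym.

Definition contract_vert := {x : nv G | roots contracted x}.

Definition cls (x : nv G) : contract_vert :=
  exist (fun x => roots contracted x) (fingraph.root contracted x) (roots_root csym x).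

Lemma cls_eq x y : (cls x == cls y) = connect contracted x y.
Proof. by rewrite -val_eqE /= root_connect. Qed.

Lemma cls_val u : cls (val u) = u.
Proof. by apply: val_inj; apply/eqP; exact: (valP u). Qed.

Definition contract_net : network R k :=
  @Network R k contract_vert
    (fun u v => (u != v) && [exists d : dart G, (cls (dart_tail d) == u) && (cls (dart_tail (al d)) == v)])
    (fun u v => \sum_(d : dart G | (cls (dart_tail d) == u) && (cls (dart_tail (al d)) == v)) om d)
    (fun i => cls (nterm G i)).

Notation H := contract_net.

Hypothesis term_sep : forall i j, cls (nterm G i) = cls (nterm G j) -> i = j.

Lemma contract_adj x y : nadj G x y -> cls x != cls y -> nadj H (cls x) (cls y).
Proof.
move=> xy nxy; rewrite /= nxy; apply/existsP.
have xyD : (x, y) \in darts G by rewrite inE.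
by exists (mk_dart xyD); rewrite /dart_tail rev_dartE /= !eqxx.
Qed.

Lemma contract_network : is_network H.
Proof.
split.
- move=> u v /=; rewrite eq_sym; congr (_ && _).
  by apply/existsP/existsP => -[d /andP[du dv]]; exists (al d); rewrite rev_dartK dv.
- by move=> u; rewrite /= eqxx.
- move=> u v _ /=; split; first exact: sumr_ge0.
  rewrite (reindex_inj (@perm_inj _ al)) /=.
  by apply: eq_big => d; rewrite ?rev_dartK ?om_al // andbC.
- by move=> i j; exact: term_sep.
move=> u v; rewrite -[u]cls_val -[v]cls_val.
have /connectP[p] := network_connected hG (val u) (val v).
elim: p (val u) => [|a p IH] x /=; first by move=> _ ->; exact: connect0.
case/andP=> xa pp E; apply: connect_trans (IH a pp E).
have [->|nxa] := eqVneq (cls x) (cls a); first exact: connect0.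
by apply: connect1; exact: contract_adj.
Qed.

Lemma contract_minor : is_minor H G.
Proof.
exists (fun u => [set x | cls x == u]); split.
- by move=> u; apply/set0Pn; exists (val u); rewrite inE cls_val.
- move=> u x y; rewrite !inE => /eqP xu /eqP yu.
  have : connect contracted x y by rewrite -cls_eq xu yu.
  case/connectP=> p; elim: p x xu => [|a p IH] x xu /=; first by move=> _ ->; exact: connect0.
  case/andP=> xa pp E; have au : cls a = u.
    by rewrite -xu; apply/eqP; rewrite eq_sym cls_eq connect1.
  apply: connect_trans (IH a au pp E); apply: connect1.
  by rewrite /= !inE (contracted_adj xa) xu au !eqxx.
- move=> u v nuv; apply/pred0P => x /=; rewrite !inE.
  by case: eqP => //= ->; apply: negbTE.
- move=> u v /= /andP[_ /existsP[d /andP[du dv]]].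
  exists (dart_tail d), (dart_tail (al d)); rewrite !inE du dv; split=> //.
  by rewrite /dart_tail rev_dartE; have := valP d; rewrite inE.
- by move=> i; rewrite inE.
Qed.

Lemma contract_cutval (W : {set contract_vert}) : cutval H W *+ 2 =
  \sum_(d : dart G | (cls (dart_tail d) \in W) (+) (cls (dart_tail (al d)) \in W)) om d.
Proof.
have cutE : cutval H W =
    \sum_(d : dart G | (cls (dart_tail d) \in W) && (cls (dart_tail (al d)) \notin W)) om d.
  rewrite (partition_big (fun d => cls (dart_tail d)) (fun u => u \in W)) /=; last first.
    by move=> d /andP[].
  apply: eq_bigr => u uW.
  rewrite [RHS](partition_big (fun d => cls (dart_tail (al d))) (fun v => v \notin W)) /=;
    last by move=> d /andP[/andP[]].
  rewrite big_mkcondr /=; apply: eq_bigr => v vW.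
  case: ifP => [_|nuv].
    apply: eq_bigl => d; case: eqP => [->|]; rewrite ?andbF //= uW.
    by case: eqP => [->|]; rewrite ?vW ?andbF.
  rewrite big_pred0 // => d; apply: contraFF nuv => /andP[/andP[_ du] dv].
  apply/andP; split; first by apply: contraNneq vW => <-.
  by apply/existsP; exists d; rewrite du dv.
rewrite mulr2n {1}cutE cutE {2}(reindex_inj (@perm_inj _ al)) /=.
rewrite [RHS](bigID (fun d => cls (dart_tail d) \in W)) /=; congr (_ + _).
  by apply: eq_bigl => d; case: (_ \in W); case: (_ \in W).
apply: eq_big => [d|d _]; rewrite ?om_al // rev_dartK.
by case: (_ \in W); case: (_ \in W).
Qed.

Lemma contract_feasible (S : {set 'I_k}) (W : {set contract_vert}) :
  cut_feasible H S W = cut_feasible G S [set x | cls x \in W].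
Proof.
apply/(cut_feasibleP contract_network)/(cut_feasibleP hG) => -[h|h]; [left|right|left|right];
  by move=> i; rewrite -h inE.
Qed.

Lemma contract_closed (chi : pred (nv G)) :
  (forall d, ~~ keep d -> chi (dart_tail d) = chi (dart_tail (al d))) ->
  exists W : {set contract_vert}, forall x, (cls x \in W) = chi x.
Proof.
move=> h; exists [set u | chi (val u)] => x; rewrite inE /=.
have /connectP[p] : connect contracted (fingraph.root contracted x) x by rewrite csym connect_root.
elim: p (fingraph.root _ _) => [|a p IH] y /=; first by move=> _ <-.
case/andP=> /existsP[d /and3P[kd /eqP <- /eqP da]] pp E.
by rewrite h // da; exact: IH.
Qed.

End Contract.

(** * Cutting the outer face open at the terminals *)

Section OpenMap.
Context {R : realType} {k : nat} (G : network R k).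
Hypothesis hG : is_network G.
Notation al := (rev_dart hG).

(* [s] is the face permutation; in [s * sg] the outer face is replaced by [k] arcs,
   the arc starting at terminal [i] being followed by the one starting at [nxt i]. *)
Record open_map (s sg : {perm dart G}) (e : 'I_k -> dart G) (nxt : 'I_k -> 'I_k) : Prop :=
  OpenMap {
    om_tail_s : forall d, dart_tail (s d) = dart_tail (al d);
    om_star : forall d d', dart_tail d = dart_tail d' -> d' \in porbit (al * s)%g d;
    om_euler : (2 * #|nv G| + 2 * #|porbits s| = #|{: dart G}| + 4)%N;
    om_term : forall i, dart_tail (e i) = nterm G i;
    om_orb : forall i j, e i \in porbit s (e j);
    om_perm_on : perm_on (e @: setT) sg;
    om_nxt : forall i, sg (e (nxt i)) = e i;
    om_dist : forall i j, e i \in porbit (s * sg)%g (e j) -> i = j;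
    om_face : forall i j, e i \in porbit (al * (s * sg))%g (e j);
    om_open_euler : (2 * #|porbits (s * sg)%g| + 2 * #|porbits (al * (s * sg))%g|
                     = #|{: dart G}| + 4)%N;
    om_conn : forall g : pred (dart G), (forall d, g ((s * sg)%g d) = g d) ->
      (forall d, g (al d) = g d) -> forall d d', g d = g d' }.

(** Two terminals and connectedness exclude isolated vertices, so vertices may be counted as cycles
    of the rotation. *)
Lemma dart_tail_surj (i j : 'I_k) : i != j -> forall x, exists d : dart G, dart_tail d = x.
Proof.
move=> ij x; have [t xt] : exists t, x != t.
  have [xi|xi] := eqVneq x (nterm G i); last by exists (nterm G i).
  by exists (nterm G j); rewrite xi (inj_eq (nterm_inj hG)).
have /connectP[[/= _ E|a p /= /andP[xa _] _]] := network_connected hG x t.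
  by rewrite E eqxx in xt.
have xaD : (x, a) \in darts G by rewrite inE.
by exists (mk_dart xaD).
Qed.

Lemma planar_open_map : (1 < k)%N -> planar_terminals_one_face G ->
  exists s sg e nxt, open_map s sg e nxt.
Proof.
move=> k1 pG.
have [s [e [tail_s tail_star euler e_term e_orb]]] := planar_map hG pG.
pose i0 := Ordinal (ltnW k1); pose i1 := Ordinal k1.
have e_inj : injective e.
  by move=> i j E; apply: (nterm_inj hG); rewrite -!e_term E.
pose r := (al * s)%g.
have tail_r d : dart_tail (r d) = dart_tail d by rewrite permM tail_s rev_dartK.
have eA i : e i \in e @: setT by exact: imset_f.
have [||sg [sgA dis mer sub cnt]] :=
  @split_porbit _ _ (e @: setT) s r (e i0) _ (@dart_tail _ _ G) erefl (eA i0) _ tail_r.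
- by move=> _ /imsetP[i _ ->]; exact: e_orb.
- move=> _ _ /imsetP[i _ ->] /imsetP[j _ ->]; rewrite !e_term => /(nterm_inj hG)->.
  by [].
have rsg : (r * sg = al * (s * sg))%g by rewrite mulgA.
rewrite rsg in mer sub cnt.
have /choice[nxt nxtE] i : exists j, sg (e j) = e i.
  have : sg^-1%g (e i) \in e @: setT by rewrite perm_closed ?perm_onV.
  by case/imsetP=> j _ E; exists j; rewrite -E permKV.
have cardr : #|porbits r| = #|nv G|.
  transitivity #|(@dart_tail _ _ G) @: {: dart G}|.
    apply: eq_card_imset_ker => d d'; split=> [/tail_star|/setP/(_ d)].
      by rewrite -eq_porbit_mem => /eqP->.
    by rewrite porbit_id => /esym/(porbit_fixed tail_r).
  rewrite -cardsT; congr #|pred_of_set _|; apply/setP => x; rewrite inE; apply/imsetP.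
  by have [d <-] := @dart_tail_surj i0 i1 isT x; exists d.
exists s, sg, e, nxt; split=> //.
- by move=> i j /dis E; apply: e_inj; exact: E.
- by move=> i j; exact: mer.
- by rewrite -mulnDr cnt cardr mulnDr addnC.
(* Gluing only enlarges the cycles around vertices, so invariance around the glued vertices implies
   invariance around the original ones. *)
- move=> g gf ga.
  have gr d : g (r d) = g d.
    apply: (porbit_fixed (s := (al * (s * sg))%g)); last by apply: sub; exact: porbit_step.
    by move=> d1; rewrite permM gf ga.
  have gs d : g (s d) = g d.
    by rewrite -(ga d) -(gr (al d)) permM rev_dartK.
  exact: (dart_conn tail_star (@dart_map_conn _ _ _ hG) gs ga).
Qed.

Variables (s sg : {perm dart G}) (e : 'I_k -> dart G) (nxt : 'I_k -> 'I_k).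
Hypothesis m : open_map s sg e nxt.

Definition dart_weight (d : dart G) : R := nw G (val d).1 (val d).2.

Definition open_dual : network R k := dual_net al (s * sg)%g e dart_weight.

Definition cut_chain (chi : pred (nv G)) : rel (nv open_dual) :=
  dual_chain (R := R) (cutfun (@dart_tail _ _ G) al chi).

Definition odd_arcs (S : {set 'I_k}) : pred 'I_k := fun i => (i \in S) (+) (nxt i \in S).

Lemma dart_weight_al d : dart_weight (al d) = dart_weight d.
Proof.
rewrite /dart_weight rev_dartE; apply: nw_sym => //.
by have := valP (al d); rewrite inE rev_dartE.
Qed.

Lemma open_dual_network : is_network open_dual.
Proof.
case: m => *; apply: dual_net_network => //.
- exact: rev_dartK.
- exact: rev_dart_neq.
- by move=> d; apply: nw_ge0 => //; have := valP d; rewrite inE.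
- exact: dart_weight_al.
Qed.

Lemma open_dual_planar (i : 'I_k) : planar_terminals_one_face open_dual.
Proof.
case: m => *; apply: dual_net_planar => //; exact: rev_dartK.
Qed.

Lemma odd_arcs_feasible (S : {set 'I_k}) (W : {set nv G}) : reflect
  (odd_arcs S =1 cut_pattern (@dart_tail _ _ G) e nxt (fun x => x \in W)) (cut_feasible G S W).
Proof.
have trans := nxt_invariant (om_perm_on m) (om_nxt m) (om_dist m) (om_orb m).
apply: (iffP (cut_feasible_pattern hG S W trans)) => h i.
  by rewrite /cut_pattern !(om_term m) h.
by rewrite -!(om_term m); exact/esym/h.
Qed.

Lemma xor_odd_arcs S : \big[addb/false]_i odd_arcs S i = false.
Proof.
have nxt_inj := nxt_inj (om_nxt m) (om_dist m).
by rewrite /odd_arcs big_split /= {1}(reindex_inj nxt_inj) addbb.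
Qed.

Lemma cut_chain_chain chi : is_chain (cut_chain chi).
Proof.
apply: dual_chain_chain => [|d]; first exact: rev_dartK.
by rewrite !ffunE rev_dartK addbC.
Qed.

Lemma bd_cut_chain_feasible S (W : {set nv G}) : cut_feasible G S W ->
  bd (cut_chain (fun x => x \in W)) =1 on_terms (odd_arcs S).
Proof.
move=> /odd_arcs_feasible h x.
rewrite /cut_chain (bd_cut_chain (rev_dartK hG) (om_tail_s m) (om_perm_on m) (om_nxt m) (om_dist m)).
by apply: eq_existsb => i; rewrite h.
Qed.

Lemma wt_cut_chain (W : {set nv G}) :
  wt (cut_chain (fun x => x \in W)) = cutval G W *+ 2.
Proof.
rewrite /cut_chain wt_dual_chain (cutval_darts hG); apply: eq_bigl => d.
by rewrite ffunE.
Qed.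

Lemma cut_of_chain (i : 'I_k) S (z : rel (nv open_dual)) : is_chain z ->
  bd z =1 on_terms (odd_arcs S) ->
  exists W : {set nv G}, cut_feasible G S W /\ z =2 cut_chain (fun x => x \in W).
Proof.
move=> cz bz.
have [chi [zE tE]] := chain_of_dual (rev_dartK hG) (rev_dart_neq hG) (om_tail_s m) (om_star m)
  (@dart_map_conn _ _ _ hG) (om_euler m) (om_perm_on m) (om_nxt m) (om_dist m) (om_orb m) i cz bz
  (xor_odd_arcs S).
exists [set x | chi x]; split.
  apply/odd_arcs_feasible => j; rewrite tE /cut_pattern !inE.
  by [].
move=> x y; rewrite zE; case: x y => [d|X] [d'|X'] //=; by rewrite !ffunE !inE.
Qed.

End OpenMap.

(** * The sparsifier dual to a distance-approximating minor *)

Section Sparsifier.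
Context {R : realType} {k : nat} (G : network R k).
Hypothesis hG : is_network G.
Notation al := (rev_dart hG).
Variables (s sg : {perm dart G}) (e : 'I_k -> dart G) (nxt : 'I_k -> 'I_k).
Hypothesis m : open_map hG s sg e nxt.
Hypothesis k_gt1 : (1 < k)%N.
Notation N := (open_dual hG s sg e).
Notation face d := (pob (s * sg)%g d).
Let hN : is_network N := open_dual_network m.

Variable M : network R k.
Hypothesis hM : is_network M.
Variable beta : nv M -> {set nv N}.
Hypothesis beta_disj : forall u v, u != v -> [disjoint beta u & beta v].
Hypothesis beta_ne : forall u, beta u != set0.
Hypothesis beta_term : forall i, nterm N i \in beta (nterm M i).
Variable U : {set nv N * nv N}.
Hypothesis U_real : realizes beta U.
Hypothesis U_min : forall U', realizes beta U' -> U' \subset U -> U' = U.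

(** A chain of the dual with boundary on the terminals uses all three parts of a dual edge or none.
    If one part is missing from [U], no such chain inside [U] crosses the edge, and it can be
    contracted. *)
Definition kept (d : dart G) : bool :=
  [&& (inl d, inl (al d)) \in U, (inl d, inr (face d)) \in U &
      (inl (al d), inr (face (al d))) \in U].

(** The middle part is charged in one direction and the outer part at [d] in both; over [d] and
    [al d] each ordered pair is charged once. *)
Definition dart_kappa (d : dart G) : R :=
  kappa beta U (inl d) (inl (al d)) + kappa beta U (inl d) (inr (face d)) +
  kappa beta U (inr (face d)) (inl d).

(** Averaged because the outer parts at [d] and [al d] may project to different edges of [M], while
    an edge weight must be symmetric. *)
Definition kept_weight (d : dart G) : R := (dart_kappa d + dart_kappa (al d)) / 2.

Let i0 := Ordinal (ltnW k_gt1).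

Let U_sym x y : ((x, y) \in U) = ((y, x) \in U).
Proof. by case: U_real => _ h _ _; apply/idP/idP => /h. Qed.

Let kappa_ge0 := kappa_ge0 hM beta_disj U_real U_min.

Lemma kept_al d : kept (al d) = kept d.
Proof. by rewrite /kept rev_dartK U_sym; case: (_ \in U) => //=; rewrite andbC. Qed.

Lemma kept_weight_ge0 d : 0 <= kept_weight d.
Proof.
by rewrite /kept_weight divr_ge0 // /dart_kappa !addr_ge0 // kappa_ge0.
Qed.

Lemma kept_weight_al d : kept_weight (al d) = kept_weight d.
Proof. by rewrite /kept_weight rev_dartK addrC. Qed.

Definition cut_dart (chi : pred (nv G)) (d : dart G) : bool :=
  chi (dart_tail d) (+) chi (dart_tail (al d)).

Notation CC := (@cut_chain _ _ _ hG s sg e).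

Lemma in_U_cut (chi : pred (nv G)) :
  in_U U (CC chi) <-> (forall d, cut_dart chi d -> kept d).
Proof.
split=> [zU d cd|h].
  have cal : cut_dart chi (al d) by rewrite /cut_dart rev_dartK addbC.
  by apply/and3P; split; apply: zU; rewrite /= ffunE ?eqxx ?porbit_id.
case=> [d|X] [d'|X'] //=.
- by rewrite ffunE => /andP[/eqP-> /h/and3P[]].
- by rewrite ffunE pobP => /andP[/eqP<- /h/and3P[]].
- by rewrite ffunE pobP U_sym => /andP[/eqP<- /h/and3P[]].
Qed.

Lemma wt_proj_cut (chi : pred (nv G)) : in_U U (CC chi) ->
  wt (proj beta (CC chi)) = \sum_(d | cut_dart chi d) kept_weight d.
Proof.
move=> zU; have [zs _] := cut_chain_chain hG s sg e chi.
rewrite (wt_proj hM beta_disj U_real U_min zs zU).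
transitivity (\sum_(d | cut_dart chi d) dart_kappa d).
  rewrite big_sumType /=.
  have -> : \sum_d \sum_(y | CC chi (inl d) y) kappa beta U (inl d) y =
     \sum_(d | cut_dart chi d) (kappa beta U (inl d) (inl (al d)) +
        kappa beta U (inl d) (inr (face d))).
    rewrite [RHS]big_mkcond; apply: eq_bigr => d _; rewrite big_sumType /=.
    rewrite ffunE -/(cut_dart chi d); case: ifP => cd.
      congr (_ + _).
        by rewrite (big_pred1 (al d)) // => d'; rewrite andbT.
      rewrite (big_pred1 (face d)) // => X.
      by rewrite andbT pobP eq_sym.
    by rewrite !big_pred0 ?addr0 // => y; rewrite andbF.
  have -> : \sum_X \sum_(y | CC chi (inr X) y) kappa beta U (inr X) y =
     \sum_(d | cut_dart chi d) kappa beta U (inr (face d)) (inl d).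
    rewrite [RHS](partition_big (fun d => face d) xpredT) //=; apply: eq_bigr => X _.
    rewrite big_sumType /= [X in _ + X]big_pred0 // addr0.
    apply: eq_big => [d|d].
      by rewrite ffunE pobP andbC.
    by rewrite pobP => /andP[/eqP ->].
  by rewrite -big_split.
rewrite /kept_weight -mulr_suml [in RHS]big_split /=.
have -> : \sum_(d | cut_dart chi d) dart_kappa (al d) = \sum_(d | cut_dart chi d) dart_kappa d.
  rewrite [RHS](reindex_inj (@perm_inj _ al)) /=; apply: eq_bigl => d.
  by rewrite /cut_dart rev_dartK addbC.
by set S := (\sum_(d | _) dart_kappa d); lra.
Qed.

Variable q : R.
Hypothesis q_ge1 : 1 <= q.
Hypothesis dist_lo : forall i j,
  dist N (nterm N i) (nterm N j) <= dist M (nterm M i) (nterm M j).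
Hypothesis dist_up : forall i j,
  dist M (nterm M i) (nterm M j) <= q * dist N (nterm N i) (nterm N j).

Lemma cut_of_minor_chain (S : {set 'I_k}) (Z : rel (nv M)) : is_chain Z ->
  bd Z =1 on_terms (odd_arcs nxt S) ->
  exists W : {set nv G}, [/\ cut_feasible G S W,
    forall d, cut_dart (fun x => x \in W) d -> kept d &
    proj beta (CC (fun x => x \in W)) =2 Z].
Proof.
move=> cZ bZ.
have [z [zs zU zb pz]] := lift_chain hN hM beta_disj beta_ne beta_term U_real U_min cZ bZ.
have zc : is_chain z by split=> // x y /zU; case: U_real => h _ _ _ /h.
have [W [fW zE]] := cut_of_chain m i0 zc zb.
exists W; split=> //.
  by apply/in_U_cut => x y; rewrite -zE; exact: zU.
move=> u v; rewrite -pz /proj; congr (_ && _).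
by apply: eq_bigr => x _; apply: eq_bigr => y _; rewrite zE.
Qed.

(** The cut becomes a join of the dual, is transferred to a join of [M], lifted to [U], and read as
    a cut again. Lying in [U], the new cut avoids all contracted edges. *)
Lemma cut_transfer (S : {set 'I_k}) (W : {set nv G}) (eps : R) : 0 < eps ->
  cut_feasible G S W ->
  exists W' : {set nv G}, [/\ cut_feasible G S W',
    forall d, cut_dart (fun x => x \in W') d -> kept d &
    \sum_(d | cut_dart (fun x => x \in W') d) kept_weight d <= q * (cutval G W *+ 2) + eps].
Proof.
move=> e0 fW.
have q0 : 0 <= q by exact: le_trans q_ge1.
have [Z [cZ bZ wZ]] := chain_transfer hN hM q0 e0 dist_up (cut_chain_chain hG s sg e _)
  (bd_cut_chain_feasible m fW).
have [W' [fW' kW' pW']] := cut_of_minor_chain cZ bZ.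
exists W'; split=> //; rewrite -wt_proj_cut; last by apply/in_U_cut.
rewrite -(wt_cut_chain hG s sg e); apply: le_trans wZ.
rewrite le_eqVlt; apply/orP; left; apply/eqP.
by apply: eq_bigr => x _; apply: eq_bigl => y; rewrite pW'.
Qed.

(** The reverse passage, by projection to [M]: distances in [M] dominate those of the dual, so the
    transfer has factor 1. *)
Lemma mincut_le_kept (S : {set 'I_k}) (W : {set nv G}) : cut_feasible G S W ->
  (forall d, cut_dart (fun x => x \in W) d -> kept d) ->
  mincut G S *+ 2 <= \sum_(d | cut_dart (fun x => x \in W) d) kept_weight d.
Proof.
move=> fW kW; have zU := (in_U_cut _).2 kW.
have [zs _] := cut_chain_chain hG s sg e (fun x => x \in W).
rewrite -wt_proj_cut //; apply/ler_addgt0Pr => eps e0.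
have d1 i j : dist N (nterm N i) (nterm N j) <= 1 * dist M (nterm M i) (nterm M j).
  by rewrite mul1r.
have [z [cz bz wz]] := chain_transfer hM hN ler01 e0 d1
  (proj_chain hM beta_disj U_real U_min zs zU)
  (bd_proj_terms hN hM beta_disj beta_term U_real U_min zs zU (bd_cut_chain_feasible m fW)).
have [W' [fW' zE]] := cut_of_chain m i0 cz bz.
rewrite mul1r in wz; apply: le_trans wz.
have -> : wt z = cutval G W' *+ 2.
  rewrite -(wt_cut_chain hG s sg e).
  by apply: eq_bigr => x _; apply: eq_bigl => y; rewrite zE.
by rewrite lerMn2r /=; exact: mincut_le.
Qed.

(** * The sparsifier and its quality *)

Definition sparsifier : network R k := contract_net kept_weight kept_al.
Notation H := sparsifier.
Notation cl := (cls kept_al).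

Lemma closed_of_kept (chi : pred (nv G)) : (forall d, cut_dart chi d -> kept d) ->
  exists W : {set nv H}, forall x, (cl x \in W) = chi x.
Proof.
move=> kchi; apply: (contract_closed (hG := hG)) => d; apply: contraNeq => nd.
by apply: kchi; rewrite /cut_dart; move: nd; case: (chi _); case: (chi _).
Qed.

Lemma kept_of_closed (W : {set nv H}) d : cut_dart (fun x => cl x \in W) d -> kept d.
Proof.
apply: contraLR => kd; rewrite /cut_dart (_ : cl (dart_tail d) = cl (dart_tail (al d))) ?addbb //.
apply/eqP; rewrite cls_eq; apply: connect1; apply/existsP; exists d.
by rewrite kd !eqxx.
Qed.

(** Transferring a cut for [[set i]] gives a cut of kept edges, which separates the classes of
    terminal [i] and of every other terminal. Only its existence matters, so the slack 1 is
    arbitrary. *)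
Lemma terminals_separated i j : cl (nterm G i) = cl (nterm G j) -> i = j.
Proof.
move=> E; apply/eqP; apply/negPn/negP => ij.
have [|W' [fW' kW' _]] := @cut_transfer [set i] (nterm G @: [set i]) 1 ltr01.
  by rewrite /cut_feasible (setIidPl _) ?eqxx //; exact/imsetS/subsetT.
have [W clW] := closed_of_kept kW'.
have /(cut_feasibleP hG) : cut_feasible G [set i] W' by [].
have ijW : (nterm G i \in W') = (nterm G j \in W') by rewrite -!clW E.
by case=> h; have := h i; have := h j; rewrite -ijW !inE eqxx eq_sym (negbTE ij) => ->.
Qed.

Lemma sparsifier_network : is_network H.
Proof.
apply: contract_network.
- exact: kept_weight_ge0.
- exact: kept_weight_al.
- exact: terminals_separated.
Qed.

Lemma sparsifier_minor : is_minor H G. Proof. exact: contract_minor. Qed.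

Lemma sparsifier_cutval (W : {set nv H}) : cutval H W *+ 2 =
  \sum_(d | cut_dart (fun x => cl x \in W) d) kept_weight d.
Proof. by rewrite /sparsifier contract_cutval //; exact: kept_weight_al. Qed.

Lemma sparsifier_feasible (S : {set 'I_k}) (W : {set nv H}) :
  cut_feasible H S W = cut_feasible G S [set x | cl x \in W].
Proof.
apply: contract_feasible.
- exact: kept_weight_ge0.
- exact: kept_weight_al.
- exact: terminals_separated.
Qed.

Lemma sparsifier_quality (S : {set 'I_k}) :
  mincut G S <= mincut H S <= q * mincut G S.
Proof.
have q0 : 0 < q by exact: lt_le_trans q_ge1.
apply/andP; split.
  apply: le_mincut => W; rewrite sparsifier_feasible => fW.
  suff: mincut G S *+ 2 <= cutval H W *+ 2 by rewrite lerMn2r.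
  rewrite sparsifier_cutval.
  have <- : \sum_(d | cut_dart (fun x => x \in [set x | cl x \in W]) d) kept_weight d =
      \sum_(d | cut_dart (fun x => cl x \in W) d) kept_weight d.
    by apply: eq_bigl => d; rewrite /cut_dart !inE.
  apply: mincut_le_kept => // d; rewrite /cut_dart !inE; exact: kept_of_closed.
rewrite mulrC -ler_pdivrMr //; apply: le_mincut => W fW.
rewrite ler_pdivrMr // mulrC.
suff: mincut H S *+ 2 <= q * (cutval G W *+ 2) by rewrite mulrnAr lerMn2r.
apply/ler_addgt0Pr => eps e0.
have [W' [fW' kW' wW']] := cut_transfer e0 fW.
have [WH clW] := closed_of_kept kW'.
apply: le_trans wW'.
have -> : \sum_(d | cut_dart (fun x => x \in W') d) kept_weight d = cutval H WH *+ 2.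
  by rewrite sparsifier_cutval; apply: eq_bigl => d; rewrite /cut_dart !clW.
rewrite lerMn2r /=; apply: (mincut_le sparsifier_network).
rewrite sparsifier_feasible (_ : [set x | _] = W') //.
by apply/setP => x; rewrite inE clW.
Qed.

(** * The size of the sparsifier *)

Let comp_chain (u : nv H) : rel (nv M) := proj beta (CC (fun x => cl x == u)).

Let comp_in_U (u : nv H) : in_U U (CC (fun x => cl x == u)).
Proof.
apply/in_U_cut => d cd; apply: (@kept_of_closed [set u]).
by move: cd; rewrite /cut_dart !inE.
Qed.

Let card_adj : (#|[set p | nadj M p.1 p.2]| <= 2 * (#|nv M| + #|nv H|))%N.
Proof.
pose Phi (W : {set nv H}) := proj beta (CC (fun x => cl x \in W)).
apply: (@card_adj_chains _ _ M hM _ _ Phi).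
  move=> Z cZ bZ.
  have odd0 : odd_arcs nxt set0 =1 xpred0 by move=> i; rewrite /odd_arcs !inE.
  have bZ' : bd Z =1 on_terms (odd_arcs nxt set0).
    by move=> u; rewrite bZ; apply/esym/existsP => -[i]; rewrite odd0 andbF.
  have [W [_ kW pW]] := cut_of_minor_chain cZ bZ'.
  have [WH clW] := closed_of_kept kW.
  exists WH => u v; rewrite -pW /Phi /proj; congr (_ && _).
  apply: eq_bigr => x _; apply: eq_bigr => y _.
  by case: x y => [d|X] [d'|X'] //=; rewrite !ffunE !clW.
rewrite -[#|nv H|]cardsT -card_powerset; apply: eq_card => Y.
by rewrite powersetE subsetT.
Qed.

(** A class without terminals is a cut for the empty terminal set, so its chain is even.
    Connectedness of [G] makes the chain nonempty, and the forest property keeps its projection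
    nonzero. *)
Let comp_card (u : nv H) : u \notin nterm H @: setT ->
  (6 <= #|[set p | comp_chain u p.1 p.2]|)%N.
Proof.
move=> nu; have zU := @comp_in_U u.
have [zs _] := cut_chain_chain hG s sg e (fun x => cl x == u).
have term_u i : (cl (nterm G i) == u) = false.
  by apply: contraNF nu => /eqP <-; exact: (imset_f (nterm H)).
have zb : bd (CC (fun x => cl x == u)) =1 xpred0.
  move=> x; rewrite (_ : CC _ = CC (fun x => x \in [set x | cl x == u])); last first.
    congr (CC _); apply/funext => y; by rewrite inE.
  rewrite (bd_cut_chain_feasible m (S := set0)).
    by apply/existsP => -[i]; rewrite /odd_arcs !inE andbF.
  by apply/(cut_feasibleP hG); left=> i; rewrite !inE term_u.
have [d cd] : exists d, cut_dart (fun x => cl x == u) d.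
  apply: contrapT => nex.
  have := @dart_map_conn _ _ _ hG (fun x => cl x == u) _ (val u) (nterm G i0).
  rewrite cls_val eqxx term_u => h; suff: true = false by [].
  apply: h => d; apply: contrapT => nd; apply: nex; exists d.
  by rewrite /cut_dart; move: nd; case: (_ == u); case: (_ == u).
have zd : CC (fun x => cl x == u) (inl d) (inl (al d)) by rewrite /= ffunE eqxx.
have [v [v' pv]] := proj_neq0 hN hM beta_disj U_real U_min zs zU zb zd.
apply: (even_chain_card hM _ _ pv).
  exact: (proj_chain hM beta_disj U_real U_min zs zU).
move=> w; rewrite /comp_chain (bd_proj hN hM beta_disj U_real U_min w zs zU) big1 // => x _.
Qed.

(** A single edge of [U] lies over [p]; it is part of the dual of one edge of [G], whose ends meet
    at most two classes. *)
Let pair_card (p : nv M * nv M) :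
  (#|[set u | comp_chain u p.1 p.2]| <= 2)%N.
Proof.
have [->|[u0]] := set_0Vmem [set u | comp_chain u p.1 p.2]; first by rewrite cards0.
rewrite inE => pu0; have [x [y [xp yp xy]]] := proj_ex pu0.
have np : p.1 != p.2 by case/andP: pu0.
(* [d] is the dart whose dual edge has [x y] as a part. Two faces are never adjacent, so any dart
   serves in that case. *)
have [d dP] : exists d, forall u, CC (fun x => cl x == u) x y -> cut_dart (fun x => cl x == u) d.
  case: x y {xp yp xy} => [d|X] [d'|X'].
  - by exists d => u /andP[_]; rewrite ffunE.
  - by exists d => u /andP[_]; rewrite ffunE.
  - by exists d' => u /andP[_]; rewrite ffunE.
  - by exists (e i0).
apply: (@leq_trans #|[set cl (dart_tail d); cl (dart_tail (al d))]|); last first.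
  by rewrite cards2; case: (_ != _).
apply: subset_leq_card; apply/subsetP => u; rewrite inE => pu.
have [x' [y' [x'p y'p xy']]] := proj_ex pu.
have [ex ey] := U_uniq hM beta_disj U_real U_min (comp_in_U xy) (comp_in_U xy') xp yp x'p y'p np.
rewrite ex ey in xy'; have := dP u xy'; rewrite /cut_dart !inE ![u == _]eq_sym.
by case: (_ == u); case: (_ == u).
Qed.

Lemma sparsifier_size : (#|nv H| <= 3 * k + 2 * #|nv M|)%N.
Proof.
pose P := [set p | nadj M p.1 p.2].
pose Q := ~: (nterm H @: [set: 'I_k]).
have chainP u p : comp_chain u p.1 p.2 -> p \in P.
  rewrite inE; case: (proj_chain hM beta_disj U_real U_min _ (@comp_in_U u)).
    by case: (cut_chain_chain hG s sg e (fun x => cl x == u)).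
  by move=> _ h /h.
have le1 : (6 * #|Q| <= \sum_(u in Q) #|[set p | comp_chain u p.1 p.2]|)%N.
  rewrite mulnC -sum_nat_const; apply: leq_sum => u; rewrite inE; exact: comp_card.
have le2 : (\sum_(u in Q) #|[set p | comp_chain u p.1 p.2]| <= \sum_(p in P) 2)%N.
  under eq_bigr => u _ do rewrite -sum1_card.
  rewrite (exchange_big_dep (mem P)) /=; last by move=> u p _; rewrite inE; exact: chainP.
  apply: leq_sum => p _; apply: leq_trans (pair_card p).
  rewrite sum1_card; apply: subset_leq_card; apply/subsetP => u.
  move=> h; have /andP[_] : (u \in Q) && (p \in [set p | comp_chain u p.1 p.2]) by exact: h.
  by rewrite !inE.
rewrite sum_nat_const in le2.
have cQ : (#|Q| + k = #|nv H|)%N.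
  rewrite -(cardsC (nterm H @: [set: 'I_k])) addnC -/Q; congr (_ + _)%N.
  by rewrite card_imset ?cardsT ?card_ord //; exact: terminals_separated.
have := card_adj; rewrite -/P => le3; move: le1 le2 le3 cQ.
set a := #|Q|; set b := #|P|; set c := #|nv M|; set d := #|nv H|.
move: (\sum_(u in Q) _)%N a b c d => t a b c d.
lia.
Qed.

End Sparsifier.

Theorem theoremG1 (R : realType) :
  exists C : R, forall (k : nat) (q s : R),
    (2 <= k)%N -> 1 <= q -> k%:R <= s ->
    (forall G : network R k, is_network G -> planar_terminals_one_face G ->
       exists H : network R k, is_DAM q s G H) ->
    (forall G : network R k, is_network G -> planar_terminals_one_face G ->
       exists H : network R k, is_minor_cut_sparsifier q (C * s) G H).
Proof.
(* [3 k + 2 n <= 5 s], as both [k] and the number [n] of vertices of the minor are at most [s]. *)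
exists 5 => k q s k2 q1 ks dam G hG pG.
have [fs [sg [e [nxt m]]]] := planar_open_map hG k2 pG.
have [M [hM [beta [b_ne b_conn b_disj b_adj b_term]] sM dM]] :=
  dam _ (open_dual_network m) (open_dual_planar m (Ordinal k2)).
have [U [U_real U_min]] := exists_minimal_realization (open_dual_network m) b_conn b_adj.
have dlo i j := proj1 (andP (dM i j)); have dup i j := proj2 (andP (dM i j)).
exists (sparsifier U_real); split.
- exact: (sparsifier_network m k2 hM b_disj b_ne b_term U_real U_min q1 dup).
- exact: sparsifier_minor.
- have := sparsifier_size m k2 hM b_disj b_ne b_term U_real U_min q1 dup.
  rewrite -(ler_nat R) natrD !natrM => /le_trans; apply.
  lra.
- move=> S _ _; exact: (sparsifier_quality m k2 hM b_disj b_ne b_term U_real U_min q1 dlo dup).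
Qed.
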